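(* Let $\mathcal C$ be a measurable space (also equipped with a topology, used to define weak convergence), and let $(\rho_{x,y})_{x,y\in\mathcal C}$ be a kernel of non-negative measures on $\mathcal C$. Let $(m_n)_{n\ge 0}$ be the two-drawing Pólya process on $\mathcal C$ with initial composition $m_0$, a non-zero finite non-negative measure, and replacement kernel $(\rho_{x,y})_{x,y\in\mathcal C}$, and let $\hat m_n=m_n/m_n(\mathcal C)$. Assume that: (B) there exists $\sigma\in(0,\infty)$ such that $\rho_{x,y}(\mathcal C)=\sigma$ for all $x,y\in\mathcal C$; (E) $\tau_\ell(\mathcal T)+\tau_r(\mathcal T)<1$, where $\mathcal T$ is the operator defined, for all signed measures $\mu,\nu$ on $\mathcal C\times\mathcal C$, by $$\mathcal T(\mu,\nu)=\frac1{\sigma^2}\int_{(x_1,x_2)\in\mathcal C\times\mathcal C}\int_{(y_1,y_2)\in\mathcal C\times\mathcal C}\rho_{x_1,x_2}\otimes\rho_{y_1,y_2}\,\mathrm d\mu(x_1,x_2)\,\mathrm d\nu(y_1,y_2).$$ Then there exists a unique probability measure $\nu$ on $\mathcal C$ satisfying $$\sigma\nu=\int_{x\in\mathcal C}\int_{y\in\mathcal C}\rho_{x,y}\,\mathrm d\nu(x)\,\mathrm d\nu(y),$$ and $\hat m_n\to\nu$ in probability as $n\to\infty$ (for the topology of weak convergence of probability measures on $\mathcal C$).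
   Context: Kernel: each $\rho_{x,y}$ is a non-negative measure on $\mathcal C$, and $(x,y)\mapsto\rho_{x,y}(A)$ is measurable on $\mathcal C\times\mathcal C$ (product $\sigma$-algebra) for every measurable $A\subseteq\mathcal C$. Two-drawing Pólya process with initial composition $m_0$ and replacement kernel $(\rho_{x,y})$: the sequence of random non-negative measures on $\mathcal C$ defined recursively, starting from $m_0$, as follows. For all $n\ge0$, given $m_n$ (and the past), sample $(C_1(n+1),C_2(n+1))$ with distribution $\hat m_n\otimes\hat m_n$ and set $m_{n+1}=m_n+\rho_{C_1(n+1),C_2(n+1)}$. Ergodicity coefficients: for a measurable space $\mathcal S$ (here $\mathcal S=\mathcal C\times\mathcal C$ with the product $\sigma$-algebra), let $\mathcal P(\mathcal S)$ be the set of probability measures on $\mathcal S$. For a Markovian kernel $\mathcal K$ on $\mathcal S$, acting on measures, $$|||\mathcal K|||=\sup_{\nu_1\ne\nu_2\in\mathcal P(\mathcal S)}\frac{\|\mathcal K(\nu_1)-\mathcal K(\nu_2)\|_{\mathrm{TV}}}{\|\nu_1-\nu_2\|_{\mathrm{TV}}}$$ (with the supremum of the empty set equal to $0$). For $\mu\in\mathcal P(\mathcal S)$ let $\mathcal T^{(\ell)}_\mu(\nu)=\mathcal T(\mu,\nu)$ and $\mathcal T^{(r)}_\mu(\nu)=\mathcal T(\nu,\mu)$. Then $$\tau_\ell(\mathcal T)=\sup_{\mu\in\mathcal P(\mathcal S)}|||\mathcal T^{(\ell)}_\mu|||,\qquad \tau_r(\mathcal T)=\sup_{\mu\in\mathcal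 P(\mathcal S)}|||\mathcal T^{(r)}_\mu|||.$$ Weak convergence in probability $\hat m_n\to\nu$ means: for every bounded continuous measurable function $f:\mathcal C\to\mathbb R$, $\int f\,\mathrm d\hat m_n\to\int f\,\mathrm d\nu$ in probability. *)

(* Defs.v *)
From HB Require Import structures.
From mathcomp Require Import all_boot all_order all_algebra.
From mathcomp Require Import all_classical all_reals all_analysis.

Set Implicit Arguments.
Unset Strict Implicit.
Unset Printing Implicit Defensive.

Import Order.TTheory GRing.Theory Num.Theory.
Import numFieldNormedType.Exports.

Local Open Scope classical_set_scope.
Local Open Scope ring_scope.
Local Open Scope ereal_scope.

(* A measurable space with a topology; no compatibility between the two
   structures is required. *)
#[short(type="measTopType")]
HB.structure Definition MeasurableTopological d :=
  {T of Measurable d T & Topological T}.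

Section charge_integral.
Context d (S : measurableType d) (R : realType).

(* Integral against a finite signed measure, through the Jordan decomposition
   (which does not depend on the chosen Hahn decomposition). *)
Definition charge_integral (mu : {charge set S -> \bar R}) (f : S -> \bar R)
    : \bar R :=
  let: exist _ exN := cid (Hahn_decomposition mu) in
  let: exist _ muPN := cid exN in
  \int[jordan_pos muPN]_x f x - \int[jordan_neg muPN]_x f x.

End charge_integral.

Section ergodicity_coefficients.
Context d (S : measurableType d) (R : realType).

(* Total variation norm of a signed measure of total mass 0, normalized so that
   the distance between probability measures is at most 1. The other usual
   normalization is twice this one; the factor cancels in [erg_norm]. *)
Definition tv_norm (mu : set S -> \bar R) : \bar R :=
  ereal_sup [set `|mu A| | A in measurable].

(* The two probability measures must differ on a measurable set: the values of
   a measure outside the sigma-algebra are irrelevant. Adding 0 to the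
   (nonnegative) ratios makes the supremum of the empty set equal to 0. *)
Definition erg_norm (K : {charge set S -> \bar R} -> set S -> \bar R)
    : \bar R :=
  ereal_sup (0 |` [set r | exists nu1 nu2 : probability S R,
    (exists2 A, measurable A & nu1 A != nu2 A) /\
    r = tv_norm (K (charge_of_finite_measure nu1) \-
                 K (charge_of_finite_measure nu2)) /
        tv_norm (nu1 \- nu2)]).

Variable T : {charge set S -> \bar R} -> {charge set S -> \bar R} ->
  set S -> \bar R.

Definition tau_l : \bar R :=
  ereal_sup [set erg_norm (fun nu => T (charge_of_finite_measure mu) nu)
            | mu in [set: probability S R]].

Definition tau_r : \bar R :=
  ereal_sup [set erg_norm (fun nu => T nu (charge_of_finite_measure mu))
            | mu in [set: probability S R]].

End ergodicity_coefficients.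

Section two_drawing.
Context d (C : measurableType d) (R : realType).
Variable rho : R.-ker (C * C)%type ~> C.

Definition pair_operator (sigma : R)
    (mu nu : {charge set (C * C)%type -> \bar R}) (A : set (C * C)%type) : \bar R :=
  (sigma ^- 2)%:E *
  charge_integral mu (fun x => charge_integral nu (fun y =>
    (rho x \x rho y) A)).

Definition balanced_fixpoint (sigma : R) (nu : probability C R) : Prop :=
  forall A, measurable A ->
    sigma%:E * nu A = \int[nu]_x \int[nu]_y rho (x, y) A.

(* The default value [\d_point] is only used when the mass is 0 or +oo. *)
Definition normalized (m : {measure set C -> \bar R}) : probability C R :=
  mnormalize m (\d_point : probability C R).

Context d' (Omega : measurableType d') (P : probability Omega R).
Variables (m0 : {measure set C -> \bar R}) (C1 C2 : nat -> {RV P >-> C}).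

(* [(C1 n, C2 n)] is the pair drawn at step [n.+1], from the composition at
   time [n]. *)
Fixpoint composition (n : nat) (w : Omega) : {measure set C -> \bar R} :=
  if n is k.+1 then measure_add (composition k w) (rho (C1 k w, C2 k w))
  else m0.

Definition norm_composition (n : nat) (w : Omega) : probability C R :=
  normalized (composition n w).

(* The sigma-algebra generated by the first [n] draws; the compositions up to
   time [n] are functions of these draws. *)
Definition past (n : nat) : set (set Omega) :=
  g_sigma_preimage (fun (k : 'I_n) w => (C1 k w, C2 k w)).

(* Given the past, the next pair has law [norm_composition n] (x)
   [norm_composition n]. *)
Definition polya_draws : Prop :=
  forall n (A : set (C * C)%type) (B : set Omega), measurable A -> past n B ->
    P (B `&` [set w | A (C1 n w, C2 n w)]) =
    \int[P]_(w in B) (norm_composition n w \x norm_composition n w) A.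

End two_drawing.

Definition weak_cvg_in_probability (R : realType) d (C : measTopType d)
    d' (Omega : measurableType d') (P : probability Omega R)
    (mhat : nat -> Omega -> probability C R) (nu : probability C R) : Prop :=
  forall f : C -> R, continuous f -> bounded_fun f -> measurable_fun setT f ->
  forall eps : R, (0 < eps)%R ->
    (fun n => P [set w |
      (eps <= `| \int[mhat n w]_x f x - \int[nu]_x f x |)%R]) @ \oo --> 0.

(* Main.v *)
From HB Require Import structures.
Require Import Defs.
From mathcomp Require Import all_boot all_order all_algebra.
From mathcomp Require Import all_classical all_reals all_analysis.
From mathcomp Require Import measurable_realfun giry ring lra.

Set Implicit Arguments.
Unset Strict Implicit.
Unset Printing Implicit Defensive.

Import Order.TTheory GRing.Theory Num.Theory.
Import numFieldNormedType.Exports.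

Local Open Scope classical_set_scope.
Local Open Scope ring_scope.

(** Write [kap z] for the probability measure [rho z / sigma] and [theta] for a
    bound on the total variation distance between any two [kap z].  On Dirac
    masses the pair operator is the product of two [kap]'s, so both
    ergodicity coefficients dominate the best such [theta]; hence the
    hypothesis on them gives [2 * theta < 1] ([ex_dobrushin]).

    Let [draw_law m] be the law of a colour drawn from [kap (x, y)] with
    [(x, y)] drawn from [m \x m].  Since two draws are made,
    [draw_law] is Lipschitz in total variation with constant
    [2 * theta < 1], so it has a unique fixed point [nu]
    ([draw_law_fixpoint_exists], [draw_law_fixpoint_unique]).

    The normalized composition [m_n] is a Markov chain on probability
    measures: [m_(n+1) = (1 - g_n) m_n + g_n kap(c_n)], with [c_n] of law
    [m_n \x m_n] and [g_n] of order [1 / n].  The noise need not vanish in total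
    variation, so the fixed point theorem does not apply pathwise.  What
    contracts is the dual action on functionals: if [Psi] is [L]-Lipschitz
    for total variation, then [m |-> E (Psi m_(n+1) | m_n = m)] is Lipschitz
    with constant [(1 - (1 - 2 * theta) g_n) L] ([step_lip]).

    This is applied to functionals [B (m, m')] of two compositions whose
    mixed second differences are at most [L r s] when the two variables are
    moved by at most [r] and [s] ([tv_mixlip]).
    Comparing the chain paired with itself and the chain paired with
    an independent copy of itself, a single step contributes a mixed second
    difference of order [g_n ^+ 2] ([step_diag]), and what has been
    accumulated before is contracted.  Therefore
    [E B (m_n, m_n) - E E' B (m_n, m'_n)] is at most [L s_n], where
    [s_(n+1) = (1 - (1 - 2 * theta) g_n) ^+ 2 * s_n + g_n ^+ 2], and
    [s_n] tends to 0 ([decouple], [cvg_decoupling]).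

    With [B] the integral of a function over the product measure, this says
    that [E (m_n \x m_n)] and [E m_n \x E m_n] are close, uniformly over
    bounded functions.  Two consequences follow: the mean measure [E m_n]
    satisfies the recursion of [draw_law] up to a vanishing error, so it
    converges to [nu] in total variation ([mean_close], [cvg_bias]); and
    the variance of [m_n f] tends to 0 for every bounded measurable [f].
    Together they give [E (m_n f - nu f) ^+ 2 --> 0] ([second_moment]) and
    the theorem by Chebyshev's inequality; continuity of [f] plays no role. *)

(** * Bounded measurable functions and probability measures *)

Section bounded_measurable.
Context d (T : measurableType d) (R : realType).
Implicit Types (f g : T -> R) (m : probability T R).

(** Bounded measurable real functions: exactly what is integrable against
    every probability measure. *)
Definition bmfun f := measurable_fun [set: T] f /\ exists K, forall x, `|f x| <= K.

Lemma bmfun_integrable m f : bmfun f -> m.-integrable [set: T] (EFin \o f).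
Proof.
move=> [mf [K fK]]; apply: measurable_bounded_integrable => //.
  by rewrite [X in (X < _)%E]probability_setT ltry.
by exists K; split; [exact: num_real|move=> M KM x _ /=; rewrite (le_trans (fK x))// ltW].
Qed.

Lemma bmfun_cst (c : R) : bmfun (fun=> c).
Proof. by split; [exact: measurable_cst|exists `|c|]. Qed.

Lemma bmfunD f g : bmfun f -> bmfun g -> bmfun (fun x => f x + g x).
Proof.
move=> [mf [K fK]] [mg [L gL]]; split; first exact: measurable_funD.
by exists (K + L) => x; rewrite (le_trans (ler_normD _ _))// lerD.
Qed.

Lemma bmfunM f g : bmfun f -> bmfun g -> bmfun (fun x => f x * g x).
Proof.
move=> [mf [K fK]] [mg [L gL]]; split; first exact: measurable_funM.
by exists (K * L) => x; rewrite normrM ler_pM.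
Qed.

Lemma bmfunZ (c : R) f : bmfun f -> bmfun (fun x => c * f x).
Proof. by move=> bf; apply: bmfunM => //; exact: bmfun_cst. Qed.

Lemma bmfunB f g : bmfun f -> bmfun g -> bmfun (fun x => f x - g x).
Proof.
move=> bf bg; rewrite [X in bmfun X](_ : _ = (fun x => f x + (-1) * g x)).
  by apply: bmfunD => //; exact: bmfunZ.
by apply/funext => x; rewrite mulN1r.
Qed.

Lemma bmfun_indic (A : set T) : measurable A -> bmfun (\1_A : T -> R).
Proof.
move=> mA; split; first exact: measurable_indic.
by exists 1 => x; rewrite indicE; case: (x \in A); rewrite ?normr1 ?normr0.
Qed.

Lemma probRintB m f g : bmfun f -> bmfun g ->
  \int[m]_x (f x - g x) = \int[m]_x f x - \int[m]_x g x.
Proof. by move=> bf bg; rewrite RintegralB//; exact: bmfun_integrable. Qed.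

Lemma probRintD m f g : bmfun f -> bmfun g ->
  \int[m]_x (f x + g x) = \int[m]_x f x + \int[m]_x g x.
Proof. by move=> bf bg; rewrite RintegralD//; exact: bmfun_integrable. Qed.

Lemma probRintZ m (c : R) f : bmfun f ->
  \int[m]_x (c * f x) = c * \int[m]_x f x.
Proof. by move=> bf; rewrite RintegralZl//; exact: bmfun_integrable. Qed.

Lemma probRint_cst m (c : R) : \int[m]_x c = c.
Proof. by rewrite Rintegral_cst// [X in fine X]probability_setT mulr1. Qed.

Lemma probRint_indic m (A : set T) : measurable A ->
  \int[m]_x (\1_A x : R) = fine (m A).
Proof. by move=> mA; rewrite /Rintegral integral_indic// setIT. Qed.

Lemma EFin_probRint m f : bmfun f ->
  (\int[m]_x f x)%:E = (\int[m]_x (f x)%:E)%E.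
Proof.
by move=> bf; rewrite /Rintegral fineK//; apply: integrable_fin_num => //;
  exact: bmfun_integrable.
Qed.

Lemma le_probRint m f g : bmfun f -> bmfun g -> (forall x, f x <= g x) ->
  \int[m]_x f x <= \int[m]_x g x.
Proof.
by move=> bf bg fg; apply: le_Rintegral => //; exact: bmfun_integrable.
Qed.

Lemma normr_probRint m f (K : R) : bmfun f -> (forall x, `|f x| <= K) ->
  `|\int[m]_x f x| <= K.
Proof.
move=> bf fK; rewrite ler_norml; apply/andP; split.
  rewrite -[leLHS](probRint_cst m); apply: le_probRint => //.
    exact: bmfun_cst.
  by move=> x; move: (fK x); rewrite ler_norml => /andP[].
rewrite -[leRHS](probRint_cst m); apply: le_probRint => //.
  exact: bmfun_cst.
by move=> x; move: (fK x); rewrite ler_norml => /andP[].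
Qed.

End bounded_measurable.

Lemma bmfun_comp d1 d2 (T1 : measurableType d1) (T2 : measurableType d2)
    (R : realType) (f : T2 -> R) (g : T1 -> T2) :
  bmfun f -> measurable_fun [set: T1] g -> bmfun (fun x => f (g x)).
Proof.
move=> [mf [K fK]] mg; split; first exact: measurableT_comp.
by exists K => x.
Qed.

(** Integrating a bounded measurable function against a probability kernel
    gives a bounded measurable function of the parameter. The integrand is
    shifted by its bound to reduce to nonnegative functions. *)
Lemma probRint_bmfun d1 d2 (X : measurableType d1) (Y : measurableType d2)
    (R : realType) (l : X -> pprobability Y R) (h : X * Y -> R) :
  measurable_fun [set: X] l -> bmfun h ->
  bmfun (fun x => \int[l x]_y h (x, y)).
Proof.
move=> ml [mh [K hK]].
have bh x : bmfun (fun y => h (x, y)).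
  by apply: (bmfun_comp (f := h)); [split => //; exists K|exact: pair1_measurable].
have K0 : 0 <= K by rewrite (le_trans _ (hK point)).
split; last by exists K => x; apply: normr_probRint.
rewrite [X in measurable_fun _ X](_ : _ =
    (fun x => fine (\int[kprobability ml x]_y (h (x, y) + K)%:E)%E - K)); last first.
  apply/funext => x; rewrite -[fine _]/(\int[l x]_y (h (x, y) + K)).
  rewrite (probRintD (l x) (bh x))//; last exact: bmfun_cst.
  by rewrite probRint_cst addrK.
apply: measurable_funB => //; apply: measurableT_comp => //.
apply: (measurable_fun_integral_finite_kernel (fun z => (h z + K)%:E)) => /=.
- by move=> z; rewrite lee_fin -lerBlDr sub0r; move: (hK z); rewrite ler_norml => /andP[].
- by apply/measurable_EFinP; exact: measurable_funD.
Qed.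

Section product.
Context d1 d2 (X : measurableType d1) (Y : measurableType d2) (R : realType).
Implicit Types (m : probability X R) (p : probability Y R).

Lemma probRint_prod m p (h : X * Y -> R) : bmfun h ->
  \int[(m \x p)%E]_z h z = \int[m]_x \int[p]_y h (x, y).
Proof.
move=> bh.
have ih : (m \x p)%E.-integrable setT (EFin \o h) by exact: bmfun_integrable.
rewrite {1}/Rintegral -integral12_prod_meas1// [in RHS]/Rintegral.
congr fine; apply: eq_integral => x _.
rewrite EFin_probRint//.
by apply: (bmfun_comp bh); exact: pair1_measurable.
Qed.

Lemma probRint_swap m p (h : X * Y -> R) : bmfun h ->
  \int[m]_x \int[p]_y h (x, y) = \int[p]_y \int[m]_x h (x, y).
Proof.
move=> bh; rewrite -probRint_prod//.
have ih : (m \x p)%E.-integrable setT (EFin \o h) by exact: bmfun_integrable.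
rewrite {1}/Rintegral -integral21_prod_meas1// [in RHS]/Rintegral.
congr fine; apply: eq_integral => x _.
rewrite EFin_probRint//.
by apply: (bmfun_comp bh); exact: pair2_measurable.
Qed.

End product.

(** The sigma-algebra on probability measures is the one generated by the
    evaluations at measurable sets. *)
Lemma measurable_pprobability d1 d2 (X : measurableType d1) (Y : measurableType d2)
    (R : realType) (l : X -> pprobability Y R) :
  (forall A, measurable A -> measurable_fun [set: X] (fun x => l x A)) <->
  measurable_fun [set: X] l.
Proof.
split=> [h|ml A mA]; last first.
  exact: (measurable_kernel (kprobability ml)).
apply: (measurability (@pset _ _ _ : set (set (pprobability Y R)))) => //.
move=> _ -[_ [r r01] [Ys mYs <-]] <-.
by apply: emeasurable_fun_infty_o => //; exact: h.
Qed.

Lemma measurable_eval d (Y : measurableType d) (R : realType) (A : set Y) :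
  measurable A -> measurable_fun [set: pprobability Y R] (fun m : pprobability Y R => m A).
Proof.
move=> mA.
exact: (iffRL (measurable_pprobability (fun m : pprobability Y R => m)) _ _ mA).
Qed.

Lemma measurable_product d1 d2 (X : measurableType d1) (Y : measurableType d2)
    (R : realType) :
  measurable_fun [set: pprobability X R * pprobability Y R]
    (fun z : pprobability X R * pprobability Y R => (z.1 \x z.2)%E : pprobability (X * Y)%type R).
Proof.
apply/measurable_pprobability => A mA.
pose i d (Z : measurableType d) (m : pprobability Z R) : giry Z R := m.
have mi d (Z : measurableType d) : measurable_fun setT (@i d Z).
  by apply: measurable_giry_codensity => // B mB; exact: measurable_eval.
have := @measurable_giry_prod _ _ X Y R => mp.
have := @measurable_giry_ev _ (X * Y)%type R A mA => mev.
have mii : measurable_fun setT (fun z : pprobability X R * pprobability Y R => (i _ _ z.1, i _ _ z.2)).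
  by apply: measurable_fun_pair; exact: measurableT_comp.
exact: (measurableT_comp mev (measurableT_comp mp mii)).
Qed.

Section probability_of_set_function.
Context d (T : measurableType d) (R : realType) (f : set T -> \bar R).
Hypotheses (f0 : f set0 = 0%E) (f_ge0 : forall A, (0 <= f A)%E)
  (fsa : semi_sigma_additive f) (f1 : f setT = 1%E).

(** A nonnegative, sigma-additive set function of total mass 1, packaged as a
    probability measure. *)
Definition prob_of_set_function_subdef : set T -> \bar R := f.
HB.instance Definition _ := isMeasure.Build _ _ _ prob_of_set_function_subdef
  f0 f_ge0 fsa.
HB.instance Definition _ := Measure_isProbability.Build _ _ _
  prob_of_set_function_subdef f1.

Lemma ex_probability_of_set_function : exists p : probability T R, forall A, p A = f A.
Proof. by exists prob_of_set_function_subdef. Qed.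

End probability_of_set_function.

(** * Total variation and the one-step operators of the urn *)

Section tv_closeness.
Context d (T : measurableType d) (R : realType).
Implicit Types (m : probability T R) (r : R).

(** The total variation distance between [m] and [m'] is at most [r], where
    the distance is the largest difference of measures of a set. A relation is
    used rather than a distance, so that no supremum is needed. *)
Definition tv_close m m' r :=
  forall A, measurable A -> `|fine (m A) - fine (m' A)| <= r.

Lemma tv_close_ge0 m m' r : tv_close m m' r -> 0 <= r.
Proof. by move=> /(_ set0 measurable0); exact: le_trans. Qed.

Lemma tv_close_refl m r : 0 <= r -> tv_close m m r.
Proof. by move=> r0 A mA; rewrite subrr normr0. Qed.

Lemma tv_close_sym m m' r : tv_close m m' r -> tv_close m' m r.
Proof. by move=> h A mA; rewrite distrC; exact: h. Qed.

Lemma tv_close_trans m2 m1 m3 r r' :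
  tv_close m1 m2 r -> tv_close m2 m3 r' -> tv_close m1 m3 (r + r').
Proof.
move=> h h' A mA; rewrite (le_trans (ler_distD (fine (m2 A)) _ _))//.
by rewrite lerD; [by []|exact: h|exact: h'].
Qed.

Lemma tv_close0_eq m m' : tv_close m m' 0 ->
  forall A, measurable A -> m A = m' A.
Proof.
move=> h A mA; move: (h A mA); rewrite normr_le0 subr_eq0 => /eqP mm'.
by rewrite -[m A]fineK ?fin_num_measure// mm' fineK// fin_num_measure.
Qed.

(** By the Jordan decomposition of [m - m'], [m] is dominated by [m'] plus a
    measure of mass at most [r]. *)
Lemma ge0_tv_close_int m m' r (f : T -> R) (K : R) : bmfun f ->
  (forall x, 0 <= f x <= K) -> tv_close m m' r ->
  \int[m]_x f x <= \int[m']_x f x + K * r.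
Proof.
move=> bf fK mm'.
have mf := bf.1.
have K0 : 0 <= K by have /andP[] := fK point; exact: le_trans.
pose nu : {charge set T -> \bar R} :=
  cadd (charge_of_finite_measure m) (copp (charge_of_finite_measure m')).
have nuE A : (nu A = m A - m' A)%E by [].
have [P [N PN]] := Hahn_decomposition nu.
pose jp := jordan_pos PN.
have [[mP _] _ _ _] := PN.
have jpT : (jp setT <= r%:E)%E.
  have -> : jp setT = crestr0 nu mP setT by exact: jordan_posE.
  rewrite /= /crestr0 mem_set//= /crestr setTI nuE.
  rewrite -[m P]fineK ?fin_num_measure// -[m' P]fineK ?fin_num_measure//.
  by rewrite -EFinB lee_fin (le_trans (ler_norm _))//; exact: mm'.
have mle A : measurable A -> (m A <= measure_add m' jp A)%E.
  move=> mA; rewrite measure_addE -leeBlDl ?fin_num_measure// -nuE.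
  rewrite (jordan_decomp PN mA)/= /cadd/= cscaleN1 geeDl//.
  by rewrite oppe_le0; exact: measure_ge0.
have := @ge0_le_measure_integral _ _ _ m (measure_add m' jp) mle (EFin \o f) setT
  measurableT.
have f0 x : (0 <= (EFin \o f) x)%E by rewrite lee_fin; have /andP[] := fK x.
have mEf : measurable_fun setT (EFin \o f) by exact/measurable_EFinP.
move=> /(_ f0 mEf); rewrite ge0_integral_measure_add//=; last by move=> x _; exact: f0.
move=> h.
rewrite -lee_fin EFinD !EFin_probRint//; apply: (le_trans h).
apply: leeD => //.
apply: (@le_trans _ _ (\int[jp]_x (cst K%:E) x)%E).
  by apply: ge0_le_integral => //= x _; rewrite lee_fin; have /andP[] := fK x.
by rewrite integral_cst// EFinM lee_wpmul2l.
Qed.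

(** Duality: integrals against two measures differ by at most the oscillation
    of the integrand times their distance. Using the oscillation, and not
    twice the sup norm, is what keeps the constant [2 * theta] below 1. *)
Lemma tv_close_int m m' r (f : T -> R) (o : R) : bmfun f ->
  (forall x y, f x - f y <= o) -> tv_close m m' r ->
  `|\int[m]_x f x - \int[m']_x f x| <= o * r.
Proof.
move=> bf fo mm'.
have [_ [K fK]] := bf.
(* Subtracting the infimum yields values between 0 and the oscillation. *)
have hlb : has_lbound (range f).
  by exists (- K) => _ [x _ <-]; move: (fK x); rewrite ler_norml => /andP[].
pose a := inf (range f).
have fa x : 0 <= f x - a <= o.
  apply/andP; split; first by rewrite subr_ge0; apply: ge_inf => //; exists x.
  rewrite lerBlDr -lerBlDl; apply: lb_le_inf; first by exists (f x), x.
  by move=> _ [y _ <-]; rewrite lerBlDr -lerBlDl.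
have bfa : bmfun (fun x => f x - a) by apply: bmfunB => //; exact: bmfun_cst.
have key p p' : tv_close p p' r -> \int[p]_x f x - \int[p']_x f x <= o * r.
  move=> /(ge0_tv_close_int bfa fa).
  rewrite !probRintB//; [|exact: bmfun_cst..].
  by rewrite !probRint_cst; lra.
rewrite ler_norml key// andbT lerNl opprB.
by apply: key; exact: tv_close_sym.
Qed.

End tv_closeness.

Section mixture.
Context d (T : measurableType d) (R : realType).
Implicit Types (m p : probability T R).

Lemma ex_mixture (g : R) m p : 0 <= g <= 1 -> exists q : probability T R,
  forall A, q A = ((1 - g)%:E * m A + g%:E * p A)%E.
Proof.
move=> /andP[g0 g1].
have g1' : 0 <= 1 - g by rewrite subr_ge0.
pose q : {measure set T -> \bar R} :=
  measure_add (mscale (NngNum g1') m) (mscale (NngNum g0) p).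
have qE A : q A = ((1 - g)%:E * m A + g%:E * p A)%E by exact: measure_addE.
have [||||q' q'E] := @ex_probability_of_set_function _ T R q.
- exact: measure0.
- exact: measure_ge0.
- exact: measure_semi_sigma_additive.
- rewrite qE [X in (_ * X + _)%E]probability_setT [X in (_ + _ * X)%E]probability_setT.
  by rewrite !mule1 -EFinD subrK.
by exists q' => A; rewrite q'E qE.
Qed.

Variables (g : R) (g01 : 0 <= g <= 1).

(** The probability measure [(1 - g) m + g p]. *)
Definition mixture m p : pprobability T R := projT1 (cid (ex_mixture m p g01)).

Lemma mixtureE m p A : (mixture m p A = (1 - g)%:E * m A + g%:E * p A)%E.
Proof. by rewrite /mixture; case: cid. Qed.

Lemma fine_mixture m p A : measurable A ->
  fine (mixture m p A) = (1 - g) * fine (m A) + g * fine (p A).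
Proof.
move=> mA; rewrite mixtureE -[m A]fineK ?fin_num_measure//.
by rewrite -[p A]fineK ?fin_num_measure.
Qed.

Lemma measurable_mixture : measurable_fun [set: pprobability T R * pprobability T R]
  (fun z => mixture z.1 z.2).
Proof.
apply/measurable_pprobability => A mA.
under eq_fun do rewrite mixtureE.
by apply: emeasurable_funD; apply: measurable_funeM;
  apply: (measurableT_comp (measurable_eval mA)).
Qed.

Lemma mixture_closel m m' p r : tv_close m m' r ->
  tv_close (mixture m p) (mixture m' p) ((1 - g) * r).
Proof.
move=> h A mA; rewrite !fine_mixture//.
have -> : (1 - g) * fine (m A) + g * fine (p A) -
  ((1 - g) * fine (m' A) + g * fine (p A)) = (1 - g) * (fine (m A) - fine (m' A)).
  ring.
move/andP: g01 => [g0 g1].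
by rewrite normrM ger0_norm ?subr_ge0// ler_wpM2l ?subr_ge0//; exact: h.
Qed.

Lemma mixture_closer m p p' r : tv_close p p' r ->
  tv_close (mixture m p) (mixture m p') (g * r).
Proof.
move=> h A mA; rewrite !fine_mixture//.
have -> : (1 - g) * fine (m A) + g * fine (p A) -
  ((1 - g) * fine (m A) + g * fine (p' A)) = g * (fine (p A) - fine (p' A)).
  ring.
move/andP: g01 => [g0 g1].
by rewrite normrM ger0_norm// ler_wpM2l//; exact: h.
Qed.

End mixture.

Section two_draws.
Context d (C : measurableType d) (R : realType).
Variable kap : (C * C)%type -> pprobability C R.
Hypothesis mkap : measurable_fun [set: C * C] kap.
Variable theta : R.
(* The Dobrushin contraction coefficient of [kap] is at most [theta]. *)
Hypothesis dobr : forall x y, tv_close (kap x) (kap y) theta.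

Local Notation M := (pprobability C R).

(** The joint law of two independent draws from [m]. *)
Definition sqprob (m : M) : pprobability (C * C)%type R := (m \x m)%E.

Lemma measurable_sqprob : measurable_fun [set: M] sqprob.
Proof.
apply: (measurableT_comp (@measurable_product _ _ C C R) (_ : measurable_fun setT (fun m : M => (m, m)))).
exact: measurable_fun_pair.
Qed.

(** The factor 2 is the cost of changing the two draws one after the other. *)
Lemma sqprob_close_int (m m' : M) r (f : C * C -> R) o : bmfun f ->
  (forall x y, f x - f y <= o) -> tv_close m m' r ->
  `|\int[sqprob m]_z f z - \int[sqprob m']_z f z| <= 2 * o * r.
Proof.
move=> bf fo mm'; rewrite !probRint_prod//.
have bx x : bmfun (fun y => f (x, y)).
  by apply: (bmfun_comp bf); exact: pair1_measurable.
have by_ y : bmfun (fun x => f (x, y)).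
  by apply: (bmfun_comp bf); exact: pair2_measurable.
have bI (p : M) : bmfun (fun x => \int[p]_y f (x, y)).
  apply: (@probRint_bmfun _ _ _ _ _ (fun=> p)) => //.
rewrite (le_trans (ler_distD (\int[m]_x \int[m']_y f (x, y)) _ _))//.
rewrite -mulrA mulr2n mulrDl !mul1r lerD//.
- rewrite -probRintB//; apply: normr_probRint; first exact: bmfunB.
  by move=> x; exact: tv_close_int.
- apply: tv_close_int => // x y; rewrite -probRintB//.
  rewrite -[leRHS](probRint_cst m' o); apply: le_probRint => //.
    exact: bmfunB.
  exact: bmfun_cst.
Qed.

(** Functionals of a probability measure that are [L]-Lipschitz for total
    variation. *)
Definition tv_lip (L : R) (Psi : M -> R) := forall (m m' : M) r,
  tv_close m m' r -> `|Psi m - Psi m'| <= L * r.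

(** Functionals of two probability measures whose mixed second differences are
    at most [L] times the product of the displacements in the two variables. *)
Definition tv_mixlip (L : R) (B : M * M -> R) := forall (m1 m2 p1 p2 : M) r s,
  tv_close m1 m2 r -> tv_close p1 p2 s ->
  `|B (m1, p1) - B (m2, p1) - (B (m1, p2) - B (m2, p2))| <= L * r * s.

Section one_step.
Variables (g : R) (g01 : 0 <= g <= 1).

(** The composition that follows [m] when the pair [c] is drawn. *)
Definition next (m : M) c : M := mixture g01 m (kap c).

Lemma measurable_next : measurable_fun [set: M * (C * C)] (fun z => next z.1 z.2).
Proof.
apply: (measurableT_comp (measurable_mixture g01) (_ : measurable_fun setT (fun z : M * (C * C) => (z.1, kap z.2)))).
by apply: measurable_fun_pair => //; exact: measurableT_comp.
Qed.

(** The expected value of [Psi] after one step of the chain started at [m]. *)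
Definition step (Psi : M -> R) (m : M) : R := \int[sqprob m]_c Psi (next m c).

(** Moving from [m] to [m'] changes the integrand through the part [1 - g] of
    the old composition that remains, and changes the law of the drawn pair;
    an integrand evaluated after different draws varies by at most [L * (g *
    theta)]. *)
Lemma step_lip L Psi : bmfun Psi -> tv_lip L Psi ->
  tv_lip ((1 - g + 2 * g * theta) * L) (step Psi).
Proof.
move=> bP lP m m' r mm'.
have bn (p : M) : bmfun (fun c => Psi (next p c)).
  apply: (bmfun_comp bP); exact: (measurableT_comp measurable_next (pair1_measurable p)).
rewrite (le_trans (ler_distD (\int[sqprob m]_c Psi (next m' c)) _ _))//.
have -> : (1 - g + 2 * g * theta) * L * r =
  L * ((1 - g) * r) + 2 * (L * (g * theta)) * r by ring.
apply: lerD.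
  rewrite -probRintB//; apply: normr_probRint; first exact: bmfunB.
  by move=> c; apply: lP; exact: mixture_closel.
apply: sqprob_close_int => // x y; rewrite (le_trans (ler_norm _))//.
by apply: lP; exact: mixture_closer.
Qed.

(** One step of the chain in the first, or second, variable only. *)
Definition step1 (B : M * M -> R) (z : M * M) := step (fun m => B (m, z.2)) z.1.
Definition step2 (B : M * M -> R) (z : M * M) := step (fun m => B (z.1, m)) z.2.

Lemma bmfun_step1 (B : M * M -> R) : bmfun B -> bmfun (step1 B).
Proof.
move=> bB.
apply: (@probRint_bmfun _ _ _ _ _ (fun z : M * M => sqprob z.1)
  (fun u : M * M * (C * C) => B (next u.1.1 u.2, u.1.2))).
  exact: measurableT_comp measurable_sqprob _.
apply: (bmfun_comp bB); apply: measurable_fun_pair.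
  apply: (measurableT_comp measurable_next (_ : measurable_fun setT (fun u : M * M * (C * C) => (u.1.1, u.2)))).
  by apply: measurable_fun_pair => //; exact: measurableT_comp.
exact: measurableT_comp.
Qed.

Lemma bmfun_swap (B : M * M -> R) : bmfun B -> bmfun (fun z : M * M => B (z.2, z.1)).
Proof. by move=> bB; apply: (bmfun_comp bB); exact: measurable_fun_pair. Qed.

Lemma bmfun_step2 (B : M * M -> R) : bmfun B -> bmfun (step2 B).
Proof. by move=> bB; exact: (bmfun_swap (bmfun_step1 (bmfun_swap bB))). Qed.

Lemma bmfun_sectl (B : M * M -> R) (p : M) : bmfun B -> bmfun (fun m : M => B (m, p)).
Proof. by move=> bB; apply: (bmfun_comp bB); exact: pair2_measurable. Qed.

Lemma bmfun_sectr (B : M * M -> R) (p : M) : bmfun B -> bmfun (fun m : M => B (p, m)).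
Proof. by move=> bB; apply: (bmfun_comp bB); exact: pair1_measurable. Qed.

Lemma bmfun_next (Psi : M -> R) m : bmfun Psi -> bmfun (fun c => Psi (next m c)).
Proof.
move=> bP; apply: (bmfun_comp bP); exact: (measurableT_comp measurable_next (pair1_measurable m)).
Qed.

(** For fixed [p1] and [p2], the difference [B (., p1) - B (., p2)] is
    Lipschitz, so [step_lip] applies to it. *)
Lemma step1_mixlip L B : bmfun B -> tv_mixlip L B ->
  tv_mixlip ((1 - g + 2 * g * theta) * L) (step1 B).
Proof.
move=> bB lB m1 m2 p1 p2 r s m12 p12.
pose Psi (m : M) := B (m, p1) - B (m, p2).
have bP : bmfun Psi by exact: (bmfunB (bmfun_sectl p1 bB) (bmfun_sectl p2 bB)).
have lP : tv_lip (L * s) Psi.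
  move=> m m' t mm'; rewrite /Psi.
  have := lB _ _ _ _ _ _ mm' p12; rewrite -mulrA (mulrC t) mulrA => /(le_trans _).
  by apply; rewrite le_eqVlt; apply/orP; left; apply/eqP; congr (`|_|); ring.
have stepP m : step Psi m = step1 B (m, p1) - step1 B (m, p2).
  by rewrite /step /Psi probRintB//; apply: (@bmfun_next (fun m => B (m, _))); exact: (bmfun_sectl _ bB).
have := step_lip bP lP m12; rewrite !stepP => h.
rewrite -[leLHS]addr0 (_ : _ * L * r * s = (1 - g + 2 * g * theta) * (L * s) * r); last by ring.
by rewrite addr0 (le_trans _ h)// le_eqVlt; apply/orP; left; apply/eqP; congr (`|_|); ring.
Qed.

Lemma tv_mixlip_swap L B : tv_mixlip L B -> tv_mixlip L (fun z => B (z.2, z.1)).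
Proof.
move=> lB m1 m2 p1 p2 r s m12 p12.
have := lB _ _ _ _ _ _ p12 m12; rewrite -mulrA (mulrC s) mulrA => /(le_trans _).
by apply; rewrite le_eqVlt; apply/orP; left; apply/eqP; congr (`|_|) => /=; ring.
Qed.

Lemma step2_mixlip L B : bmfun B -> tv_mixlip L B ->
  tv_mixlip ((1 - g + 2 * g * theta) * L) (step2 B).
Proof.
move=> bB lB.
exact: (tv_mixlip_swap (step1_mixlip (bmfun_swap bB) (tv_mixlip_swap lB))).
Qed.

(** The effect of using the same draw in both variables instead of two
    independent draws. *)
Lemma step_diag L B m : bmfun B -> tv_mixlip L B ->
  `|\int[sqprob m]_c B (next m c, next m c) - step1 (step2 B) (m, m)|
    <= L * (g * theta) ^+ 2.
Proof.
move=> bB lB.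
set p := sqprob m.
pose G (u : (C * C) * (C * C)) := B (next m u.1, next m u.2).
have mn : measurable_fun setT (next m).
  exact: (measurableT_comp measurable_next (pair1_measurable m)).
have bG : bmfun G.
  apply: (bmfun_comp bB); apply: measurable_fun_pair.
    exact: measurableT_comp mn _.
  exact: measurableT_comp mn _.
have mp d' (X : measurableType d') d'' (Y : measurableType d'') (q : probability Y R) (h : X * Y -> R) :
    bmfun h -> bmfun (fun x => \int[q]_y h (x, y)).
  by move=> bh; apply: (@probRint_bmfun _ _ _ _ _ (fun=> q)).
have bG11 : bmfun (fun u : (C * C) * (C * C) => G (u.1, u.1)).
  by apply: (bmfun_comp bG); exact: measurable_fun_pair.
have bG22 : bmfun (fun u : (C * C) * (C * C) => G (u.2, u.2)).
  by apply: (bmfun_comp bG); exact: measurable_fun_pair.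
have bG21 : bmfun (fun u : (C * C) * (C * C) => G (u.2, u.1)).
  by apply: (bmfun_comp bG); exact: measurable_fun_pair.
have bGd : bmfun (fun c => G (c, c)).
  by apply: (bmfun_comp bG); exact: measurable_fun_pair.
set D := \int[p]_c G (c, c); set E := \int[p]_c \int[p]_c' G (c, c').
have -> : step1 (step2 B) (m, m) = E by [].
(* The mixed second difference between the points [c] and [c'], averaged over
   independent [c] and [c'], is twice the quantity to be bounded. *)
have DE : \int[(p \x p)%E]_u ((G (u.1, u.1) - G (u.2, u.1)) - (G u - G (u.2, u.2))) =
    2 * (D - E).
  rewrite !probRintB//; [|exact: bmfunB..].
  rewrite (probRint_prod p p bG11) (probRint_prod p p bG22).
  rewrite (probRint_prod p p bG21) (probRint_prod p p bG) /=.
  have -> : \int[p]_x \int[p]_y G (y, x) = E by exact: (esym (probRint_swap p p bG)).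
  have -> : \int[p]_x \int[p]_y G (y, y) = D by exact: (probRint_cst p D).
  have -> : \int[p]_x \int[p]_y G (x, x) = D.
    by apply: eq_Rintegral => x _; exact: probRint_cst.
  by rewrite -/E; ring.
have H : `|2 * (D - E)| <= L * (g * theta) * (g * theta).
  rewrite -DE; apply: normr_probRint; first by do 2 apply: bmfunB => //.
  move=> [c c']; rewrite /G/=.
  by apply: lB; apply: mixture_closer; exact: dobr.
have -> : L * (g * theta) ^+ 2 = L * (g * theta) * (g * theta) by ring.
rewrite (le_trans _ H)// normrM (ger0_norm (_ : 0 <= 2))//.
by rewrite ler_peMl// ler1n.
Qed.

End one_step.
End two_draws.

(** * Mixtures of probability measures and the fixed point *)

Section tv_completeness.
Context d (T : measurableType d) (R : realType).

Lemma fine_sum_measure (m : probability T R) (F : nat -> set T) n :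
  (forall i, measurable (F i)) -> trivIset setT F ->
  \sum_(i < n) fine (m (F i)) = fine (m (\big[setU/set0]_(i < n) F i)).
Proof.
move=> mF tF; rewrite measure_bigsetU// sum_fine// => i _.
exact: fin_num_measure.
Qed.

(** Completeness for total variation. The limit is the setwise limit; its
    sigma-additivity follows from uniformity over measurable sets. *)
Lemma tv_complete (nu : nat -> probability T R) (e : nat -> R) :
  e @ \oo --> 0 ->
  (forall k k', (k <= k')%N -> tv_close (nu k) (nu k') (e k)) ->
  exists p : probability T R, forall k, tv_close (nu k) p (e k).
Proof.
move=> e0 cl.
pose u A k : R := fine (nu k A).
pose g A := limn (u A).
have cu A : measurable A -> u A @ \oo --> g A.
  move=> mA; suff : cauchy_ex (u A @ \oo) by move=> /cauchy_exP/cauchy_cvg.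
  move=> eps eps0; have /cvgr0Pnorm_lt/(_ _ eps0)[N _ HN] := e0.
  exists (u A N); exists N => // k /= Nk; rewrite -ball_normE /ball_/=.
  rewrite (le_lt_trans (cl _ _ Nk _ mA))// (le_lt_trans (ler_norm _))//.
  exact: (HN _ (leqnn N)).
have cll k (s : nat -> R) l : s @ \oo --> l -> 
    forall c : R, (forall k', (k <= k')%N -> `|c - s k'| <= e k) -> `|c - l| <= e k.
  move=> sl c h.
  have hc : (fun k' => `|c - s k'|) @ \oo --> `|c - l|.
    by apply: cvg_norm; apply: cvgB => //; exact: cvg_cst.
  apply: (cvgr_to_le hc).
  by exists k.
have ug A k : measurable A -> `|u A k - g A| <= e k.
  by move=> mA; apply: (cll k (u A)); [exact: cu|move=> k' kk'; exact: cl].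
have g_ge0 A : measurable A -> 0 <= g A.
  move=> mA; apply: (cvgr_to_ge (cu _ mA)).
  by apply: nearW => k; rewrite /u fine_ge0.
(* The absolute value makes [f] nonnegative on nonmeasurable sets as well. *)
pose f A : \bar R := `|g A|%:E.
have fE A : measurable A -> f A = (g A)%:E.
  by move=> mA; rewrite /f ger0_norm ?g_ge0.
have u0 k : u set0 k = 0 by rewrite /u measure0.
have u1 k : u setT k = 1 by rewrite /u [X in fine X]probability_setT.
have gcst A c : measurable A -> (forall k, u A k = c) -> g A = c.
  move=> mA uc; apply: (cvg_unique _ (cu _ mA)) => //.
  by rewrite (_ : u A = cst c); [exact: cvg_cst|apply/funext].
have [||||p pE] := @ex_probability_of_set_function _ T R f.
- by rewrite fE// (gcst _ 0).
- by move=> A; rewrite /f lee_fin.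
- move=> F mF tF mU; rewrite fE//.
  rewrite (_ : (fun n => _) = (fun n => (\sum_(0 <= i < n) g (F i))%:E)); last first.
    by apply/funext => n; rewrite -sumEFin; apply: eq_bigr => i _; exact: fE.
  apply: cvg_EFin; first exact: nearW.
  rewrite /comp/=; apply/cvgrPdist_le => eps eps0.
  have eps3 : 0 < eps / 3 by rewrite divr_gt0.
  have /cvgr0Pnorm_lt/(_ _ eps3)[k _ /(_ _ (leqnn k)) Hk] := e0.
  have ek : e k <= eps / 3 by rewrite (le_trans (ler_norm _))// ltW.
  have : (fun n => \sum_(0 <= i < n) u (F i) k) @ \oo --> u (\bigcup_n F n) k.
    have := @measure_semi_sigma_additive _ _ _ (nu k) F mF tF mU.
    rewrite -[X in _ --> X]fineK ?fin_num_measure// => /fine_cvg.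
    apply: cvg_trans; apply: near_eq_cvg; apply: nearW => n /=.
    by rewrite sum_fine// => i _; exact: fin_num_measure.
  move=> /cvgrPdist_le/(_ _ eps3); apply: filterS => n Hn.
  have Hs : `|\sum_(0 <= i < n) u (F i) k - \sum_(0 <= i < n) g (F i)| <= e k.
    apply: (cll k (fun k' => \sum_(0 <= i < n) u (F i) k')).
      by apply: cvg_big => [|i _]; [exact: add_continuous|exact: cu].
    move=> k' kk'; rewrite !big_mkord !fine_sum_measure//.
    by apply: cl => //; exact: bigsetU_measurable.
  have HU := ug _ k mU.
  have -> : g (\bigcup_n F n) - \sum_(0 <= i < n) g (F i) =
    (g (\bigcup_n F n) - u (\bigcup_n F n) k) +
    (u (\bigcup_n F n) k - \sum_(0 <= i < n) u (F i) k) +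
    (\sum_(0 <= i < n) u (F i) k - \sum_(0 <= i < n) g (F i)) by ring.
  rewrite (le_trans (ler_normD _ _))// (le_trans (lerD (ler_normD _ _) (lexx _)))//.
  by move: HU; rewrite distrC; lra.
- by rewrite fE// (gcst _ 1).
exists p => k A mA; rewrite pE fE//=.
exact: ug.
Qed.

End tv_completeness.

Section bind.
Context d1 d2 (X : measurableType d1) (Y : measurableType d2) (R : realType).
Variables (m : probability X R) (k : X -> pprobability Y R).
Hypothesis mk : measurable_fun [set: X] k.

Let giry_k (x : X) : giry Y R := k x.

Let measurable_giry_k : measurable_fun [set: X] giry_k.
Proof.
by apply: measurable_giry_codensity => // B mB; exact: (iffRL (measurable_pprobability k)).
Qed.

Lemma ex_bind : exists q : probability Y R,
  forall f : Y -> R, bmfun f -> \int[q]_y f y = \int[m]_x \int[k x]_y f y.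
Proof.
pose q0 := giry_bind (m : giry X R) measurable_giry_k.
have q0E (f : Y -> \bar R) : measurable_fun setT f -> (forall y, 0 <= f y)%E ->
    (\int[q0]_y f y = \int[m]_x \int[k x]_y f y)%E.
  by move=> mf f0; exact: (giry_int_bind _ _ mf f0).
have [||||q qE] := @ex_probability_of_set_function _ Y R q0.
- exact: measure0.
- exact: measure_ge0.
- exact: measure_semi_sigma_additive.
- rewrite -[LHS]mul1e -integral_cst// q0E// -[RHS](probability_setT m).
  rewrite -[RHS]mul1e -integral_cst//; apply: eq_integral => x _.
  by rewrite integral_cst// mul1e [LHS]probability_setT.
exists q => f bf; have [mf [K fK]] := bf.
have bI : bmfun (fun x => \int[k x]_y f y).
  by apply: (@probRint_bmfun _ _ _ _ _ k (fun z => f z.2)) => //;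
    apply: (bmfun_comp bf).
have fK0 y : 0 <= f y + K by rewrite -lerBlDr sub0r; move: (fK y); rewrite ler_norml => /andP[].
have bK := bmfun_cst Y K.
have e1 : \int[q]_y (f y + K) = \int[q]_y f y + K.
  by rewrite probRintD// probRint_cst.
have e2 : \int[m]_x (\int[k x]_y f y + K) = \int[m]_x \int[k x]_y f y + K.
  by rewrite probRintD ?probRint_cst//; exact: bmfun_cst.
apply: (addIr K); rewrite -e1 -e2.
apply: EFin_inj; rewrite !EFin_probRint//; last 2 first.
- by apply: bmfunD => //; exact: bmfun_cst.
- by apply: bmfunD.
transitivity (\int[q0]_y (f y + K)%:E)%E.
  by apply: eq_measure_integral => A mA _; exact: qE.
rewrite q0E//.
- apply: eq_integral => x _.
  rewrite -EFin_probRint; last exact: bmfunD.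
  by congr EFin; rewrite probRintD// probRint_cst.
- by apply/measurable_EFinP; exact: measurable_funD.
Qed.

(** The mixture of the measures [k x] when [x] has law [m]. *)
Definition bind : probability Y R := projT1 (cid ex_bind).

Lemma bind_int (f : Y -> R) : bmfun f ->
  \int[bind]_y f y = \int[m]_x \int[k x]_y f y.
Proof. exact: (projT2 (cid ex_bind)). Qed.

Lemma bindE A : measurable A -> fine (bind A) = \int[m]_x fine (k x A).
Proof.
move=> mA; rewrite -probRint_indic// bind_int; last exact: bmfun_indic.
by apply: eq_Rintegral => x _; exact: probRint_indic.
Qed.

End bind.

Section fixpoint.
Context d (C : measurableType d) (R : realType).
Variable kap : (C * C)%type -> pprobability C R.
Hypothesis mkap : measurable_fun [set: C * C] kap.
Variable theta : R.
Hypothesis dobr : forall x y, tv_close (kap x) (kap y) theta.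
Hypothesis theta2 : 2 * theta < 1.

Lemma bmfun_kap A : measurable A -> bmfun (fun c => fine (kap c A)).
Proof.
move=> mA; split.
  by apply: measurableT_comp => //; exact: (iffRL (measurable_pprobability kap)).
exists 1 => c; rewrite ger0_norm ?fine_ge0// -lee_fin fineK ?fin_num_measure//.
exact: probability_le1.
Qed.

Lemma theta_ge0 : 0 <= theta.
Proof. exact: tv_close_ge0 (dobr point point). Qed.

(** The law of a colour drawn from [kap (x, y)] when [x] and [y] are
    independent, both of law [m]. *)
Definition draw_law (m : pprobability C R) : probability C R := bind (sqprob m) mkap.

Lemma draw_lawE m A : measurable A -> fine (draw_law m A) = \int[sqprob m]_c fine (kap c A).
Proof. exact: bindE. Qed.

Lemma draw_law_contraction m m' r : tv_close m m' r ->
  tv_close (draw_law m) (draw_law m') (2 * theta * r).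
Proof.
move=> mm' A mA; rewrite !draw_lawE//.
apply: sqprob_close_int => //; first exact: bmfun_kap.
by move=> x y; rewrite (le_trans (ler_norm _))//; exact: dobr.
Qed.

Lemma iter_draw_law_contraction m m' n :
  tv_close (iter n draw_law m) (iter n draw_law m') ((2 * theta) ^+ n).
Proof.
elim: n => [A mA|n IH]; last by rewrite exprS /=; exact: draw_law_contraction.
rewrite /= expr0.
have b (p : probability C R) : 0 <= fine (p A) <= 1.
  by rewrite fine_ge0//= -lee_fin fineK ?fin_num_measure//; exact: probability_le1.
by move: (b m) (b m') => /andP[? ?] /andP[? ?]; rewrite ler_norml; lra.
Qed.

Lemma cvg_theta : (fun n => (2 * theta) ^+ n) @ \oo --> 0.
Proof.
by apply: cvg_expr; rewrite ger0_norm// mulr_ge0// theta_ge0.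
Qed.

(** Closeness with bounds tending to 0 is closeness with bound 0. *)
Lemma tv_close_null (m m' : probability C R) (e : nat -> R) : e @ \oo --> 0 ->
  (forall n, tv_close m m' (e n)) -> tv_close m m' 0.
Proof.
move=> e0 h A mA; apply: (cvgr_to_ge e0).
by apply: nearW => n; exact: h.
Qed.

Lemma draw_law_fixpoint_unique (m m' : probability C R) :
  tv_close (draw_law m) m 0 -> tv_close (draw_law m') m' 0 -> tv_close m m' 0.
Proof.
move=> h h'; apply: (tv_close_null cvg_theta) => n.
have it (p : probability C R) : tv_close (draw_law p) p 0 -> tv_close (iter n draw_law p) p 0.
  move=> hp; elim: n => [|n IH]; first exact: tv_close_refl.
  rewrite iterS -[0]addr0; apply: (tv_close_trans _ hp).
  by rewrite -[0](mulr0 (2 * theta)); exact: draw_law_contraction.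
have := tv_close_trans (tv_close_sym (it _ h)) (iter_draw_law_contraction m m' n).
by move=> /tv_close_trans/(_ (it _ h')); rewrite add0r addr0.
Qed.

Lemma draw_law_fixpoint_exists : exists nu : probability C R, tv_close (draw_law nu) nu 0.
Proof.
pose nu n : probability C R := iter n draw_law (\d_(point : C)).
have cl k k' : (k <= k')%N -> tv_close (nu k) (nu k') ((2 * theta) ^+ k).
  move=> kk'; rewrite /nu -(subnKC kk') iterD.
  exact: iter_draw_law_contraction.
have [p hp] := tv_complete cvg_theta cl.
(* Both [draw_law p] and [p] are close to the next iterate. *)
exists p; apply: (@tv_close_null _ _ (fun k => 2 * (2 * theta) ^+ k)).
  rewrite -[0](mulr0 2); apply: cvgM; first exact: cvg_cst.
  exact: cvg_theta.
move=> k.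
have h1 := draw_law_contraction (tv_close_sym (hp k)).
have h2 := tv_close_trans h1 (hp k.+1).
move=> A mA; rewrite (le_trans (h2 A mA))// exprS -mulr2n -[leLHS]mulr_natl mulrA.
rewrite (_ : 2 * (2 * theta) * (2 * theta) ^+ k = 2 * (2 * theta ) ^+ k * (2 * theta)); last by ring.
apply: ler_piMr; last exact: ltW.
by rewrite mulr_ge0// exprn_ge0// mulr_ge0// theta_ge0.
Qed.

End fixpoint.

(** * Convergence of the abstract urn process *)

(** A discrete Gronwall lemma: [x] tends to 0 when it contracts at rate [c * g
    n] with [g] not summable, up to an error that is negligible compared with
    [g n]. *)
Lemma cvg_recursion (R : realType) (c : R) (g e x : nat -> R) :
  0 < c -> (forall n, 0 <= g n) -> (forall n, c * g n <= 1) ->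
  series g @ \oo --> +oo -> e @ \oo --> 0 -> (forall n, 0 <= x n) ->
  (forall n, x n.+1 <= (1 - c * g n) * x n + g n * e n) -> x @ \oo --> 0.
Proof.
move=> c0 g0 cg1 gy e0 x0 xS; apply/cvgr0Pnorm_le => eps eps0.
have eps2 : 0 < eps / 2 by rewrite divr_gt0.
have /cvgr0Pnorm_lt/(_ _ (mulr_gt0 c0 eps2))[N _ HN] := e0.
pose S k := \sum_(N <= i < k) g i.
(* Past rank [N] the excess over [eps / 2] is multiplied by [1 - c * g k], and
   the product of these factors is at most the inverse of [1 + c * S k]. *)
pose Y := Num.max (x N - eps / 2) 0.
have Y0 : 0 <= Y by rewrite /Y le_max lexx orbT.
have S0 k : 0 <= S k by exact: sumr_ge0.
have key k : (N <= k)%N -> (x k - eps / 2) * (1 + c * S k) <= Y.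
  elim: k => [|k IH].
    rewrite leqn0 => /eqP N0; rewrite /S N0 big_geq// mulr0 addr0 mulr1.
    by rewrite /Y N0 le_max lexx.
  rewrite leq_eqVlt => /predU1P[<-|].
    by rewrite /S big_geq// mulr0 addr0 mulr1 /Y le_max lexx.
  rewrite ltnS => Nk; move: (IH Nk).
  rewrite /S big_nat_recr//= -/(S k).
  have ek : e k <= c * (eps / 2) by rewrite (le_trans (ler_norm _))// ltW// HN.
  have := xS k; have := g0 k; have := cg1 k; have := S0 k.
  set y := x k - eps / 2; set y' := x k.+1 - eps / 2.
  move: (g k) (S k) => G Sk Sk0 cG G0 xk h.
  have y'y : y' <= (1 - c * G) * y.
    rewrite /y' /y; have := ler_wpM2l G0 ek; lra.
  have cS0 : 0 <= c * Sk by rewrite mulr_ge0// ltW.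
  have cG0 : 0 <= c * G by rewrite mulr_ge0// ltW.
  have p1 : 0 <= 1 + c * (Sk + G) by rewrite mulrDr; lra.
  apply: (le_trans (ler_wpM2r p1 y'y)).
  have [y0|y0] := leP y 0.
    apply: le_trans Y0; apply: mulr_le0_ge0 => //.
    by apply: mulr_ge0_le0 => //; lra.
  apply: le_trans h; rewrite (mulrDr c).
  move: (c * Sk) (c * G) cS0 cG0 cG => a b a0 b0 b1.
  have -> : (1 - b) * y * (1 + (a + b)) = y * (1 + a - b * a - b * b) by ring.
  by rewrite ler_pM2l//; have := mulr_ge0 b0 a0; have := mulr_ge0 b0 b0; lra.
have [k0 _ Hk0] := cvgry_ge gy (\sum_(0 <= i < N) g i + Y / (c * (eps / 2))).
exists (maxn N k0) => // k /=; rewrite geq_max => /andP[Nk k0k].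
rewrite ger0_norm//.
have ySk := key _ Nk.
have : Y / (c * (eps / 2)) <= S k.
  by have := Hk0 _ k0k; rewrite /series /= (big_cat_nat (leq0n N) Nk)/= lerD2l.
rewrite ler_pdivrMr; last exact: mulr_gt0.
move=> YS.
have : (x k - eps / 2) * (1 + c * S k) <= (eps / 2) * (1 + c * S k).
  apply: (le_trans ySk); apply: (le_trans YS).
  rewrite mulrDr mulr1 (_ : S k * _ = eps / 2 * (c * S k)); last by ring.
  by rewrite lerDr ltW.
rewrite ler_pM2r; last by rewrite ltr_pwDl// mulr_ge0// ltW.
by lra.
Qed.

Section process.
Context d (C : measurableType d) (R : realType).
Variable kap : (C * C)%type -> pprobability C R.
Hypothesis mkap : measurable_fun [set: C * C] kap.
Variable theta : R.
Hypothesis dobr : forall x y, tv_close (kap x) (kap y) theta.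
Hypothesis theta2 : 2 * theta < 1.
Variables (g : nat -> R).
Hypothesis g01 : forall n, 0 <= g n <= 1.
Context d' (Omega : measurableType d') (P : probability Omega R).
Variables (m : nat -> Omega -> pprobability C R) (c : nat -> Omega -> (C * C)%type).
Hypothesis mm : forall n, measurable_fun [set: Omega] (m n).
Hypothesis mc : forall n, measurable_fun [set: Omega] (c n).
(* The initial composition is deterministic. *)
Hypothesis m0 : forall w w', m 0%N w = m 0%N w'.
Hypothesis mS : forall n w, m n.+1 w = next kap (g01 n) (m n w) (c n w).
(* Given [m n], the pair [c n] has law [sqprob (m n)]. *)
Hypothesis markov : forall n (F : pprobability C R * (C * C) -> R), bmfun F ->
  \int[P]_w F (m n w, c n w) = \int[P]_w \int[sqprob (m n w)]_x F (m n w, x).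

Local Notation M := (pprobability C R).
Local Notation nxt := (fun n => next kap (g01 n)).

Let th0 : 0 <= theta := theta_ge0 dobr.

Let sqr_th1 : theta ^+ 2 <= 1.
Proof.
have th1 : theta <= 1 by have h0 := th0; have h2 := theta2; lra.
by rewrite expr2 mulr_ile1.
Qed.

(** Bound on the defect between the chain paired with itself and the chain
    paired with an independent copy. *)
Fixpoint decoupling (n : nat) : R :=
  if n is k.+1 then (1 - (1 - 2 * theta) * g k) ^+ 2 * decoupling k + (g k) ^+ 2
  else 0.

Let rho_bounds n : 0 <= 1 - (1 - 2 * theta) * g n <= 1.
Proof.
have /andP[gn0 gn1] := g01 n.
have h1 : 0 <= theta * g n by rewrite mulr_ge0.
have h2 : 0 <= (1 - 2 * theta) * g n by rewrite mulr_ge0// subr_ge0 ltW.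
have -> : (1 - (1 - 2 * theta) * g n) = 1 - g n + 2 * (theta * g n) by ring.
apply/andP; split; first by lra.
by move: h2; rewrite mulrBl mul1r -mulrA; lra.
Qed.

Lemma decoupling_ge0 n : 0 <= decoupling n.
Proof. by case: n => //= n; elim: n => [|n IH] /=; rewrite addr_ge0// ?sqr_ge0// mulr_ge0// sqr_ge0. Qed.

Lemma cvg_decoupling : g @ \oo --> 0 -> series g @ \oo --> +oo ->
  decoupling @ \oo --> 0.
Proof.
move=> g0 gy.
apply: (@cvg_recursion _ (1 - 2 * theta) g g) => //.
- by rewrite subr_gt0.
- by move=> n; have /andP[] := g01 n.
- by move=> n; have := rho_bounds n; rewrite subr_ge0 => /andP[].
- exact: decoupling_ge0.
move=> n /=; rewrite expr2 lerD// ler_wpM2r ?decoupling_ge0//.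
by rewrite ler_piMl//; have /andP[] := rho_bounds n.
Qed.

Let mpair n k : measurable_fun [set: Omega * Omega] (fun u : Omega * Omega => (m n u.1, m k u.2)).
Proof. by apply: measurable_fun_pair; exact: measurableT_comp. Qed.

Lemma step_markov n (Psi : M -> R) : bmfun Psi ->
  \int[P]_w Psi (m n.+1 w) = \int[P]_w step kap (g01 n) Psi (m n w).
Proof.
move=> bP; pose G (z : M * (C * C)) := Psi (nxt n z.1 z.2).
transitivity (\int[P]_w G (m n w, c n w)).
  by apply: eq_Rintegral => w _; rewrite /G/= mS.
by apply: markov; apply: (bmfun_comp bP); exact: measurable_next.
Qed.

(** Proved for all functionals at once: the induction hypothesis is applied to
    [B] averaged over the last step of both variables, whose mixed constant
    has been contracted twice. *)
Lemma decouple n (B : M * M -> R) L : bmfun B -> tv_mixlip L B ->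
  `|\int[P]_w B (m n w, m n w) - \int[P]_w \int[P]_w' B (m n w, m n w')|
    <= L * decoupling n.
Proof.
elim: n B L => [|n IH] B L bB lB.
  rewrite mulr0 normr_le0 subr_eq0; apply/eqP; apply: eq_Rintegral => w _.
  rewrite -[LHS](probRint_cst P); apply: eq_Rintegral => w' _.
  by rewrite (m0 w' w).
have bS2 := bmfun_step2 mkap (g01 n) bB.
have bS := bmfun_step1 mkap (g01 n) bS2.
have mnx := measurable_next mkap (g01 n).
pose F (z : M * (C * C)) := B (nxt n z.1 z.2, nxt n z.1 z.2).
have bF : bmfun F.
  by apply: (bmfun_comp bB); apply: measurable_fun_pair.
have bBB n1 n2 (D : M * M -> R) : bmfun D ->
    bmfun (fun u : Omega * Omega => D (m n1 u.1, m n2 u.2)).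
  by move=> bD; apply: (bmfun_comp bD); exact: mpair.
have bdiag (D : M * M -> R) : bmfun D -> bmfun (fun w => D (m n w, m n w)).
  by move=> bD; apply: (bmfun_comp bD); exact: measurable_fun_pair.
have e1 : \int[P]_w B (m n.+1 w, m n.+1 w) =
    \int[P]_w \int[sqprob (m n w)]_x F (m n w, x).
  by rewrite -markov//; apply: eq_Rintegral => w _; rewrite /F/= !mS.
have e2 : \int[P]_w \int[P]_w' B (m n.+1 w, m n.+1 w') =
    \int[P]_w \int[P]_w' step1 kap (g01 n) (step2 kap (g01 n) B) (m n w, m n w').
  (* The last step is averaged out in one copy at a time. *)
  set B2 := step2 kap (g01 n) B in bS2 bS *.
  transitivity (\int[P]_w \int[P]_w' B2 (m n.+1 w, m n w')).
    apply: eq_Rintegral => w _.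
    exact: (step_markov n (bmfun_sectr (m n.+1 w) bB)).
  transitivity (\int[P]_w' \int[P]_w B2 (m n.+1 w, m n w')).
    exact: (probRint_swap P P (bBB n.+1 n B2 bS2)).
  transitivity (\int[P]_w' \int[P]_w step1 kap (g01 n) B2 (m n w, m n w')).
    apply: eq_Rintegral => w' _.
    exact: (step_markov n (bmfun_sectl (m n w') bS2)).
  exact: (esym (probRint_swap P P (bBB n n _ bS))).
rewrite e1 e2.
set B' := step1 kap (g01 n) (step2 kap (g01 n) B).
rewrite (le_trans (ler_distD (\int[P]_w B' (m n w, m n w)) _ _))//= mulrDr addrC.
apply: lerD.
  have := IH B' ((1 - g n + 2 * g n * theta) * ((1 - g n + 2 * g n * theta) * L)) bS.
  rewrite (_ : _ * (_ * L) * _ = L * ((1 - (1 - 2 * theta) * g n) ^+ 2 * decoupling n)); last by ring.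
  apply; apply: (step1_mixlip mkap dobr) => //.
  exact: (step2_mixlip mkap dobr).
have L0 : 0 <= L.
  have := lB _ _ _ _ _ _ (tv_close_refl (point : M) ler01) (tv_close_refl (point : M) ler01).
  by rewrite !mulr1; exact: le_trans.
have bFI : bmfun (fun w => \int[sqprob (m n w)]_x F (m n w, x)).
  apply: (@probRint_bmfun _ _ _ _ _ (fun w => sqprob (m n w)) (fun u => F (m n u.1, u.2))).
    by apply: measurableT_comp => //; exact: measurable_sqprob.
  apply: (bmfun_comp bF); apply: measurable_fun_pair => //.
  exact: measurableT_comp.
rewrite -(probRintB P bFI (bdiag _ bS)).
apply: normr_probRint; first exact: (bmfunB bFI (bdiag _ bS)).
move=> w; apply: (le_trans (step_diag mkap dobr (g01 n) (m n w) bB lB)).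
rewrite exprMn; apply: (ler_wpM2l L0).
exact: (ler_piMr (sqr_ge0 _) sqr_th1).
Qed.

(** The mean composition at time [n], a probability measure on colours. *)
Definition mean n : probability C R := bind P (mm n).

(** The integral of [h] against the product of two measures. *)
Definition pairing (h : C * C -> R) (z : M * M) : R :=
  \int[z.1]_x \int[z.2]_y h (x, y).

Lemma pairing_diag h mu : bmfun h -> pairing h (mu, mu) = \int[sqprob mu]_z h z.
Proof. by move=> bh; rewrite /pairing/= -probRint_prod. Qed.

Lemma bmfun_pairing h : bmfun h -> bmfun (pairing h).
Proof.
move=> bh; rewrite (_ : pairing h = fun z : M * M => \int[(z.1 \x z.2)%E]_u h u).
  apply: (@probRint_bmfun _ _ _ _ _ (fun z : M * M => (z.1 \x z.2)%E : pprobability _ R)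
    (fun u => h u.2)).
    exact: measurable_product.
  by apply: (bmfun_comp bh).
by apply/funext => z; rewrite /pairing probRint_prod.
Qed.

Let bmsec (h : C * C -> R) (x : C) : bmfun h -> bmfun (fun y => h (x, y)).
Proof. by move=> bh; apply: (bmfun_comp bh); exact: pair1_measurable. Qed.

Let bmint (h : C * C -> R) (p : M) : bmfun h -> bmfun (fun x => \int[p]_y h (x, y)).
Proof. by move=> bh; apply: (@probRint_bmfun _ _ _ _ _ (fun=> p)). Qed.

Lemma pairing_mixlip h o : bmfun h -> (forall x y, h x - h y <= o) ->
  tv_mixlip (2 * o) (pairing h).
Proof.
move=> bh ho m1 m2 p1 p2 r s m12 p12; rewrite /pairing/=.
pose phi x := \int[p1]_y h (x, y) - \int[p2]_y h (x, y).
have bphi : bmfun phi by apply: bmfunB; exact: bmint.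
have phis x : `|phi x| <= o * s.
  by apply: tv_close_int => //; exact: bmsec.
have -> : \int[m1]_x \int[p1]_y h (x, y) - \int[m2]_x \int[p1]_y h (x, y) -
  (\int[m1]_x \int[p2]_y h (x, y) - \int[m2]_x \int[p2]_y h (x, y)) =
  \int[m1]_x phi x - \int[m2]_x phi x.
  by rewrite /phi !probRintB; [ring|exact: bmint..].
rewrite (_ : 2 * o * r * s = (2 * (o * s)) * r); last by ring.
apply: tv_close_int => // x y.
have := phis x; have := phis y; rewrite !ler_norml => /andP[? ?] /andP[? ?]; lra.
Qed.

Lemma mean_pairing n h : bmfun h ->
  \int[P]_w \int[P]_w' pairing h (m n w, m n w') = pairing h (mean n, mean n).
Proof.
move=> bh; rewrite {2}/pairing/= bind_int; last exact: bmint.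
apply: eq_Rintegral => w _; rewrite /pairing/=.
transitivity (\int[m n w]_x \int[P]_w' \int[m n w']_y h (x, y)); last first.
  by apply: eq_Rintegral => x _; rewrite bind_int//; exact: bmsec.
pose H (u : Omega * C) := \int[m n u.1]_y h (u.2, y).
have bH : bmfun H.
  apply: (@probRint_bmfun _ _ _ _ _ (fun u : Omega * C => m n u.1) (fun v => h (v.1.2, v.2))).
    exact: measurableT_comp.
  apply: (bmfun_comp bh); apply: measurable_fun_pair => //.
  exact: measurableT_comp.
rewrite -(probRint_swap P (m n w) bH).
by [].
Qed.

Lemma decouple_pairing n h o : bmfun h -> (forall x y, h x - h y <= o) ->
  `|\int[P]_w pairing h (m n w, m n w) - pairing h (mean n, mean n)|
    <= 2 * o * decoupling n.
Proof.
move=> bh ho; rewrite -mean_pairing//; apply: decouple.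
  exact: bmfun_pairing.
exact: pairing_mixlip.
Qed.

(** Bound on the distance between the mean composition and the fixed point. *)
Fixpoint bias (n : nat) : R :=
  if n is k.+1 then
    (1 - (1 - 2 * theta) * g k) * bias k + g k * (2 * decoupling k)
  else 1.

Lemma bias_ge0 n : 0 <= bias n.
Proof.
elim: n => //= n IH; have /andP[? _] := rho_bounds n.
have /andP[? _] := g01 n.
by rewrite addr_ge0// mulr_ge0// mulr_ge0// decoupling_ge0.
Qed.

Lemma cvg_bias : g @ \oo --> 0 -> series g @ \oo --> +oo -> bias @ \oo --> 0.
Proof.
move=> g0 gy.
apply: (@cvg_recursion _ (1 - 2 * theta) g (fun n => 2 * decoupling n)) => //.
- by rewrite subr_gt0.
- by move=> n; have /andP[] := g01 n.
- by move=> n; have := rho_bounds n; rewrite subr_ge0 => /andP[].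
- rewrite -[0](mulr0 2); apply: cvgM; first exact: cvg_cst.
  exact: cvg_decoupling.
- exact: bias_ge0.
Qed.

Variable nu : probability C R.
Hypothesis nufix : tv_close (draw_law mkap nu) nu 0.

Lemma prob01 (p : probability C R) A : measurable A -> 0 <= fine (p A) <= 1.
Proof.
by move=> mA; rewrite fine_ge0//= -lee_fin fineK ?fin_num_measure//; exact: probability_le1.
Qed.

Lemma mean_close n : tv_close (mean n) nu (bias n).
Proof.
elim: n => [|n IH] A mA /=.
  have /andP[? ?] := prob01 (mean 0) mA; have /andP[? ?] := prob01 nu mA.
  by rewrite ler_norml; lra.
have bk := bmfun_kap mkap mA.
have bev k : bmfun (fun w => fine (m k w A)).
  split; first by apply: measurableT_comp => //; exact: (iffRL (measurable_pprobability (m k))).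
  by exists 1 => w; have /andP[? ?] := prob01 (m k w) mA; rewrite ger0_norm.
have bE : bmfun (fun z : M * (C * C) => fine (kap z.2 A)) by exact: (bmfun_comp bk).
have bkc : bmfun (fun w => fine (kap (c n w) A)).
  exact: (bmfun_comp bk).
set h := fun c => fine (kap c A) in bk.
(* The mean composition obeys the recursion of the chain, with the pair drawn
   from the mean of [m n \x m n] instead of [mean n \x mean n]. *)
have eS : fine (mean n.+1 A) = (1 - g n) * fine (mean n A) +
    g n * \int[P]_w pairing h (m n w, m n w).
  rewrite !bindE//.
  transitivity (\int[P]_w ((1 - g n) * fine (m n w A) + g n * fine (kap (c n w) A))).
    by apply: eq_Rintegral => w _; rewrite mS fine_mixture.
  rewrite probRintD; [|exact: bmfunZ..].
  rewrite !probRintZ//; congr (_ + _ * _).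
  have := markov n bE => /= ->; apply: eq_Rintegral => w _.
  by rewrite pairing_diag.
have ho x y : h x - h y <= 1.
  by have /andP[? ?] := prob01 (kap x) mA; have /andP[? ?] := prob01 (kap y) mA; rewrite /h; lra.
have h1 := decouple_pairing n bk ho.
have h2 : `|pairing h (mean n, mean n) - fine (nu A)| <= 2 * theta * bias n.
  rewrite pairing_diag// -draw_lawE//.
  have := tv_close_trans (draw_law_contraction mkap dobr IH) nufix mA.
  by rewrite addr0; apply.
have h3 := IH A mA.
rewrite eS.
have /andP[gn0 gn1] := g01 n.
set X := \int[P]_w _ in h1 *; set Y := pairing h _ in h1 h2.
set a := fine (mean n A) in h3 *; set v := fine (nu A) in h2 h3 *.
have -> : (1 - g n) * a + g n * X - v =
   (1 - g n) * (a - v) + g n * (X - Y) + g n * (Y - v) by ring.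
rewrite (le_trans (ler_normD _ _))// (le_trans (lerD (ler_normD _ _) (lexx _)))//.
rewrite !normrM (ger0_norm gn0) (ger0_norm (_ : 0 <= 1 - g n)) ?subr_ge0//.
have k1 := ler_wpM2l (_ : 0 <= 1 - g n) h3.
have k2 := ler_wpM2l gn0 h1.
have k3 := ler_wpM2l gn0 h2.
rewrite (le_trans (lerD (lerD (k1 _) k2) k3)) ?subr_ge0//.
by rewrite le_eqVlt; apply/orP; left; apply/eqP; ring.
Qed.

Lemma second_moment n (f : C -> R) (K : R) : bmfun f -> (forall x, `|f x| <= K) ->
  \int[P]_w (\int[m n w]_x f x - \int[nu]_x f x) ^+ 2 <=
    4 * K ^+ 2 * decoupling n + (2 * K * bias n) ^+ 2.
Proof.
move=> bf fK.
set v := \int[nu]_x f x.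
pose h (z : C * C) := f z.1 * f z.2.
have bh : bmfun h.
  by apply: bmfunM; apply: (bmfun_comp bf).
have pE (p q : M) : pairing h (p, q) = (\int[p]_x f x) * (\int[q]_x f x).
  rewrite /pairing/h/= mulrC -probRintZ//; apply: eq_Rintegral => x _.
  by rewrite probRintZ// mulrC.
have ho x y : h x - h y <= 2 * K ^+ 2.
  have hK z : `|h z| <= K ^+ 2 by rewrite /h normrM expr2 ler_pM.
  by have := hK x; have := hK y; rewrite !ler_norml => /andP[? ?] /andP[? ?]; lra.
have h1 := decouple_pairing n bh ho.
pose a := \int[mean n]_x f x.
have bI : bmfun (fun w => \int[m n w]_x f x).
  by apply: (@probRint_bmfun _ _ _ _ _ (m n) (fun z => f z.2)) => //; apply: (bmfun_comp bf).
have av : `|a - v| <= 2 * K * bias n.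
  apply: tv_close_int => //; last exact: mean_close.
  by move=> x y; have := fK x; have := fK y; rewrite !ler_norml => /andP[? ?] /andP[? ?]; lra.
(* Variance plus squared bias: for [h] the product of two copies of [f],
   [pairing h] is the product of the two integrals of [f]. *)
have -> : \int[P]_w (\int[m n w]_x f x - v) ^+ 2 =
   (\int[P]_w pairing h (m n w, m n w) - pairing h (mean n, mean n)) + (a - v) ^+ 2.
  rewrite pE -/a.
  transitivity (\int[P]_w (pairing h (m n w, m n w) - ((2 * v) * \int[m n w]_x f x - v ^+ 2))).
    by apply: eq_Rintegral => w _; rewrite pE; ring.
  rewrite probRintB.
  - rewrite probRintB; [|exact: bmfunZ|exact: bmfun_cst].
    rewrite probRintZ// probRint_cst.
    have -> : \int[P]_w \int[m n w]_x f x = a by rewrite /a bind_int.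
    by ring.
  - under eq_fun do rewrite pE.
    exact: bmfunM.
  - by apply: bmfunB; [exact: bmfunZ|exact: bmfun_cst].
apply: lerD; last by rewrite -[leLHS]real_normK ?num_real// lerXn2r// ?nnegrE// (le_trans _ av).
rewrite (le_trans (ler_norm _))// (le_trans h1)// le_eqVlt; apply/orP; left; apply/eqP; ring.
Qed.

(** Convergence in probability of [m n] against every bounded measurable
    function; continuity is not needed. *)
Lemma process_cvg (f : C -> R) (eps : R) : bmfun f -> 0 < eps ->
  g @ \oo --> 0 -> series g @ \oo --> +oo ->
  (fun n => P [set w | eps <= `|\int[m n w]_x f x - \int[nu]_x f x|]) @ \oo --> 0%E.
Proof.
move=> bf eps0 g0 gy; have [_ [K fK]] := bf.
pose u n := 4 * K ^+ 2 * decoupling n + (2 * K * bias n) ^+ 2.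
have u0 : (fun n => eps ^- 2 * u n) @ \oo --> 0.
  have cd := cvg_decoupling g0 gy; have cb := cvg_bias g0 gy.
  have c1 : (fun n => 4 * K ^+ 2 * decoupling n) @ \oo --> 0.
    by rewrite -[0](mulr0 (4 * K ^+ 2)); apply: cvgM => //; exact: cvg_cst.
  have c2 : (fun n => 2 * K * bias n) @ \oo --> 0.
    by rewrite -[0](mulr0 (2 * K)); apply: cvgM => //; exact: cvg_cst.
  have c3 : (fun n => (2 * K * bias n) ^+ 2) @ \oo --> 0.
    by rewrite -[0](mulr0 0); apply: cvgM.
  rewrite -[0](mulr0 (eps ^- 2)); apply: cvgM; first exact: cvg_cst.
  by rewrite -[0](addr0 0); apply: cvgD.
have bX n : bmfun (fun w => \int[m n w]_x f x - \int[nu]_x f x).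
  apply: bmfunB; last exact: bmfun_cst.
  by apply: (@probRint_bmfun _ _ _ _ _ (m n) (fun z => f z.2)) => //; apply: (bmfun_comp bf).
have mE n : measurable [set w | eps <= `|\int[m n w]_x f x - \int[nu]_x f x|].
  have mX : measurable_fun setT (fun w => `|\int[m n w]_x f x - \int[nu]_x f x|).
    by apply: measurableT_comp => //; exact: (bX n).1.
  rewrite (_ : [set w | _] = (fun w => `|\int[m n w]_x f x - \int[nu]_x f x|) @^-1` `[eps, +oo[); last first.
    by apply/seteqP; split => w /=; rewrite in_itv/= andbT.
  by rewrite -[X in measurable X]setTI; apply: mX => //; exact: measurable_itv.
have PE n : (P [set w | (eps <= `|\int[m n w]_x f x - \int[nu]_x f x|)%R] <= (eps ^- 2 * u n)%:E)%E.
  rewrite -[leLHS]fineK ?fin_num_measure// lee_fin -probRint_indic//.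
  have bX2 : bmfun (fun w => eps ^- 2 * (\int[m n w]_x f x - \int[nu]_x f x) ^+ 2).
    by apply: bmfunZ; under eq_fun do rewrite expr2; exact: bmfunM.
  apply: (@le_trans _ _ (\int[P]_w (eps ^- 2 * (\int[m n w]_x f x - \int[nu]_x f x) ^+ 2))).
    apply: le_probRint => //; first exact: bmfun_indic.
    move=> w; rewrite indicE; case: (boolP (w \in _)) => /=; last first.
      by move=> _; rewrite mulr_ge0 ?sqr_ge0// invr_ge0 sqr_ge0.
    rewrite inE/= => ew; rewrite mulrC ler_pdivlMr ?exprn_gt0// mul1r.
    by rewrite -[leRHS]real_normK ?num_real// lerXn2r// nnegrE ltW.
  rewrite probRintZ; last by under eq_fun do rewrite expr2; exact: bmfunM.
  by rewrite ler_wpM2l ?invr_ge0 ?sqr_ge0//; exact: second_moment.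
apply: (@squeeze_cvge _ _ _ _ (fun=> 0%E) _ (fun n => (eps ^- 2 * u n)%:E)).
- by apply: nearW => n; rewrite measure_ge0 PE.
- exact: cvg_cst.
- by apply: cvg_EFin => //; exact: nearW.
Qed.

End process.

(** * The contraction coefficient read off the ergodicity coefficients *)

Section charge_integral_measure.
Local Open Scope ereal_scope.
Context d (T : measurableType d) (R : realType).

(** For a nonnegative measure, the Jordan decomposition is trivial. *)
Lemma charge_integral_measure (mu : {finite_measure set T -> \bar R})
    (f : T -> \bar R) :
  charge_integral (charge_of_finite_measure mu) f = \int[mu]_x f x.
Proof.
rewrite /charge_integral; case: cid => Q exN; case: cid => N QN.
have [[mQ _] [mN Nneg] QUN QIN] := QN.
have jnE A : measurable A -> jordan_neg QN A = 0.
  move=> mA; have AN0 : mu (A `&` N) = 0.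
    apply/eqP; rewrite eq_le measure_ge0 andbT.
    by apply: (Nneg (A `&` N)); [exact: measurableI|exact: subIsetr].
  rewrite jordan_negE cjordan_negE /crestr0 mem_set// /crestr.
  by transitivity (- mu (A `&` N)); rewrite // AN0 oppe0.
have jpE A : measurable A -> jordan_pos QN A = mu A.
  move=> mA; have := jordan_decomp QN mA; rewrite /cadd/= cscaleN1.
  by rewrite [X in _ - X]jnE// sube0 => <-.
rewrite (@eq_measure_integral _ _ _ _ mu); last by move=> A mA _; exact: jpE.
rewrite [X in _ - X](@eq_measure_integral _ _ _ _ mzero); last first.
  by move=> A mA _; exact: jnE.
by rewrite integral_measure_zero sube0.
Qed.

Lemma charge_integral_dirac (a : T) (f : T -> \bar R) :
  measurable_fun [set: T] f ->
  charge_integral (charge_of_finite_measure (\d_a : probability T R)) f = f a.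
Proof.
by move=> mf; rewrite charge_integral_measure integral_dirac// diracT mul1e.
Qed.

Lemma erg_norm_ge0 (K : {charge set T -> \bar R} -> set T -> \bar R) :
  0 <= erg_norm K.
Proof. by apply: ereal_sup_ubound; left. Qed.

Lemma tv_norm_dirac (a b : T) (A : set T) : measurable A ->
  \d_a A != \d_b A :> \bar R ->
  tv_norm ((\d_a : set T -> \bar R) \- (\d_b : set T -> \bar R)) = 1.
Proof.
move=> mA ab; apply/eqP; rewrite eq_le; apply/andP; split.
  apply: ge_ereal_sup => _ [B mB <-]; rewrite !diracE.
  by case: (a \in B); case: (b \in B);
    rewrite ?subee// ?sube0 ?sub0e ?abseN /= ?normrN ?normr1 ?normr0 ?lee_fin ?ler01.
apply: ereal_sup_ubound; exists A => //; move: ab; rewrite !diracE.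
by case: (a \in A); case: (b \in A); rewrite ?eqxx// => _;
  rewrite ?subee// ?sube0 ?sub0e ?abseN /= ?normrN ?normr1.
Qed.

(** Two Dirac masses that differ on a measurable set are at distance 1, so the
    corresponding ratio is its own numerator. *)
Lemma erg_norm_dirac (K : {charge set T -> \bar R} -> set T -> \bar R)
    (a b : T) (A B : set T) :
  measurable A -> \d_a A != \d_b A :> \bar R -> measurable B ->
  `|K (charge_of_finite_measure (\d_a : probability T R)) B -
    K (charge_of_finite_measure (\d_b : probability T R)) B| <= erg_norm K.
Proof.
move=> mA ab mB.
apply: (@le_trans _ _ (tv_norm (K (charge_of_finite_measure (\d_a : probability T R)) \-
  K (charge_of_finite_measure (\d_b : probability T R))))).
  by apply: ereal_sup_ubound; exists B.
apply: ereal_sup_ubound; right; exists \d_a, \d_b; split; first by exists A.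
by rewrite (tv_norm_dirac mA ab) inve1 mule1.
Qed.

End charge_integral_measure.

Section dobrushin.
Local Open Scope ereal_scope.
Context d (C : measurableType d) (R : realType).
Variable rho : R.-ker (C * C)%type ~> C.
Variable sigma : R.
Hypotheses (sigma_gt0 : (0 < sigma)%R)
  (rhoT : forall x y : C, rho (x, y) setT = sigma%:E).
Local Notation S := (C * C)%type.

Lemma rho_le z A : measurable A -> rho z A <= sigma%:E.
Proof.
by case: z => x y mA; rewrite -(rhoT x y); apply: le_measure; rewrite ?inE.
Qed.

Lemma rho_fin z A : measurable A -> rho z A \is a fin_num.
Proof. by move=> mA; rewrite ge0_fin_numE// (le_lt_trans (rho_le z mA))// ltry. Qed.

Lemma rho_prodl x y A : measurable A ->
  (rho x \x rho y) (A `*` setT) = sigma%:E * rho x A.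
Proof.
move=> mA; rewrite /product_measure1/=.
transitivity (\int[rho x]_z (sigma * \1_A z)%:E).
  apply: eq_integral => z _; rewrite indicE.
  have [zA|zA] := boolP (z \in A).
    by rewrite in_xsectionX// mulr1; case: (y) => *; exact: rhoT.
  by rewrite notin_xsectionX// measure0 mulr0.
under eq_integral do rewrite EFinM.
rewrite ge0_integralZl//; [|exact/measurable_EFinP|by rewrite lee_fin ltW].
by rewrite integral_indic// setIT.
Qed.

Lemma rho_prodr x y A : measurable A ->
  (rho x \x rho y) (setT `*` A) = sigma%:E * rho y A.
Proof.
move=> mA; rewrite /product_measure1/=.
transitivity (\int[rho x]_z cst (fine (rho y A))%:E z).
  by apply: eq_integral => z _; rewrite in_xsectionX ?inE//= fineK// rho_fin.
by rewrite integral_cst//= fineK ?rho_fin// muleC; congr (_ * _); case: (x).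
Qed.

Let msrho A : measurable A -> measurable_fun [set: S] (fun x => sigma%:E * rho x A).
Proof. by move=> mA; apply: measurable_funeM; exact: measurable_kernel. Qed.

(** On two Dirac masses the pair operator is a product measure; its marginals
    are the normalized replacement measures. *)
Lemma pair_operator_diracl a b A : measurable A ->
  pair_operator rho sigma (charge_of_finite_measure (\d_a : probability S R))
    (charge_of_finite_measure (\d_b : probability S R)) (A `*` setT) =
  (sigma^-1)%:E * rho a A.
Proof.
move=> mA; rewrite /pair_operator.
under [X in charge_integral _ X]eq_fun => x.
  rewrite (_ : (fun y => _) = cst (sigma%:E * rho x A)); last first.
    by apply/funext => y; rewrite rho_prodl.
  rewrite charge_integral_dirac//; over.
rewrite charge_integral_dirac; last exact: msrho.
by rewrite /= muleA -EFinM expr2 invfM -mulrA mulVf ?mulr1// gt_eqF.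
Qed.

Lemma pair_operator_diracr a b A : measurable A ->
  pair_operator rho sigma (charge_of_finite_measure (\d_a : probability S R))
    (charge_of_finite_measure (\d_b : probability S R)) (setT `*` A) =
  (sigma^-1)%:E * rho b A.
Proof.
move=> mA; rewrite /pair_operator.
under [X in charge_integral _ X]eq_fun => x.
  rewrite (_ : (fun y => _) = (fun y => sigma%:E * rho y A)); last first.
    by apply/funext => y; rewrite rho_prodr.
  rewrite charge_integral_dirac; last exact: msrho. over.
rewrite charge_integral_dirac//.
by rewrite /= muleA -EFinM expr2 invfM -mulrA mulVf ?mulr1// gt_eqF.
Qed.

(** When [rho p A] and [rho q A] differ, [p] and [q] are separated by the
    level set of [rho . A]. *)
Lemma dirac_separates (p q : S) A : measurable A -> rho p A != rho q A ->
  exists2 B, measurable B & \d_p B != \d_q B :> \bar R.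
Proof.
move=> mA pq; exists ((fun z => rho z A) @^-1` [set rho p A]).
  rewrite -[X in measurable X]setTI.
  have := measurable_kernel rho A mA measurableT.
  by apply; exact: emeasurable_set1.
rewrite !diracE mem_set// memNset; last by move=> /= qp; rewrite qp eqxx in pq.
by rewrite eqe oner_eq0.
Qed.

Lemma tau_r_ge p q A : measurable A ->
  `|(sigma^-1)%:E * rho p A - (sigma^-1)%:E * rho q A| <= tau_r (pair_operator rho sigma).
Proof.
move=> mA.
apply: (@le_trans _ _ (erg_norm (fun nu => pair_operator rho sigma nu
    (charge_of_finite_measure (\d_(point : S) : probability S R))))); last first.
  by apply: ereal_sup_ubound; exists \d_(point : S).
have [->|/(dirac_separates mA)[B mB pq]] := eqVneq (rho p A) (rho q A).
  rewrite subee ?abse0 ?erg_norm_ge0//.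
  by rewrite fin_numM// rho_fin.
by rewrite -!(pair_operator_diracl _ point)//; apply: erg_norm_dirac mB pq _;
  exact: measurableX.
Qed.

Lemma tau_l_ge p q A : measurable A ->
  `|(sigma^-1)%:E * rho p A - (sigma^-1)%:E * rho q A| <= tau_l (pair_operator rho sigma).
Proof.
move=> mA.
apply: (@le_trans _ _ (erg_norm (fun nu => pair_operator rho sigma
    (charge_of_finite_measure (\d_(point : S) : probability S R)) nu))); last first.
  by apply: ereal_sup_ubound; exists \d_(point : S).
have [->|/(dirac_separates mA)[B mB pq]] := eqVneq (rho p A) (rho q A).
  rewrite subee ?abse0 ?erg_norm_ge0//.
  by rewrite fin_numM// rho_fin.
by rewrite -!(pair_operator_diracr point)//; apply: erg_norm_dirac mB pq _;
  exact: measurableX.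
Qed.

(** Both ergodicity coefficients bound the distance between normalized
    replacement measures; the smaller one serves as [theta]. *)
Lemma ex_dobrushin :
  tau_l (pair_operator rho sigma) + tau_r (pair_operator rho sigma) < 1 ->
  exists2 theta : R, (2 * theta < 1)%R & forall p q A, measurable A ->
    (`|sigma^-1 * fine (rho p A) - sigma^-1 * fine (rho q A)| <= theta)%R.
Proof.
move: (@tau_l_ge) (@tau_r_ge).
move: (tau_l _) (tau_r _) => tl tr hl hr tlr.
have key (t : \bar R) : (forall p q A, measurable A ->
    `|(sigma^-1)%:E * rho p A - (sigma^-1)%:E * rho q A| <= t) -> 0 <= t.
  by move=> h; exact: le_trans (h point point set0 measurable0).
have tl0 : 0 <= tl := key tl hl.
have tr0 : 0 <= tr := key tr hr.
have ltf (t : \bar R) : 0 <= t -> t < 1 -> t \is a fin_num.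
  by move=> t0 t1; rewrite ge0_fin_numE// (lt_trans t1)// ltry.
have ftl : tl \is a fin_num by apply: ltf => //; rewrite (le_lt_trans _ tlr)// leeDl.
have ftr : tr \is a fin_num by apply: ltf => //; rewrite (le_lt_trans _ tlr)// leeDr.
move: hl hr tlr.
rewrite -(fineK ftl) -(fineK ftr) -EFinD lte_fin => hl hr lr.
have conv (t : R) : (forall p q A, measurable A ->
    `|(sigma^-1)%:E * rho p A - (sigma^-1)%:E * rho q A| <= t%:E) ->
  forall p q A, measurable A ->
    (`|sigma^-1 * fine (rho p A) - sigma^-1 * fine (rho q A)| <= t)%R.
  move=> h p q A mA; have := h p q A mA.
  by rewrite -(fineK (rho_fin p mA)) -(fineK (rho_fin q mA)) -!EFinM -EFinB abse_EFin lee_fin.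
have [tt|tt] := leP (fine tl) (fine tr).
  by exists (fine tl); [lra|exact: conv].
by exists (fine tr); [lra|exact: conv].
Qed.

End dobrushin.

(** * The two-drawing process as an abstract urn process *)

Section dirac_mixtures.
Context d (T : measurableType d) (R : realType).

Lemma probRint_dirac (a : T) (f : T -> R) : measurable_fun [set: T] f ->
  \int[\d_a]_x f x = f a.
Proof.
move=> mf; rewrite /Rintegral integral_dirac//; last exact/measurable_EFinP.
by rewrite diracT mul1e.
Qed.

Lemma measurable_pdirac :
  measurable_fun [set: T] (fun a : T => \d_a : pprobability T R).
Proof.
by apply/measurable_pprobability => A mA; exact: measurable_fun_dirac.
Qed.

Lemma fine_eq_prob (p q : probability T R) A : measurable A ->
  fine (p A) = fine (q A) -> p A = q A.
Proof.
move=> mA pq; rewrite -[p A]fineK ?fin_num_measure// pq fineK//.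
exact: fin_num_measure.
Qed.

Lemma eq_probRint (p q : probability T R) (f : T -> R) :
  (forall A, measurable A -> p A = q A) -> \int[p]_x f x = \int[q]_x f x.
Proof.
by move=> pq; rewrite /Rintegral (eq_measure_integral q)// => A mA _; exact: pq.
Qed.

End dirac_mixtures.

Section urn.
Context d (C : measurableType d) (R : realType).
Variables (rho : R.-ker (C * C)%type ~> C) (sigma : R).
Hypotheses (sigma_gt0 : 0 < sigma)
  (rhoT : forall x y : C, rho (x, y) setT = sigma%:E).
Variable m0 : {finite_measure set C -> \bar R}.
Hypothesis m0_neq0 : m0 setT != 0%E.
Local Notation S := (C * C)%type.
Local Notation M := (pprobability C R).

(** The replacement measure [rho z] normalized to mass 1. The default value
    plays no role, since all masses are positive. *)
Definition color_law (z : S) : M := mnormalize (rho z) point.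

Lemma color_lawE z A : (color_law z A = rho z A * (sigma^-1)%:E)%E.
Proof.
have rT : rho z setT = sigma%:E by case: z => x y; exact: rhoT.
by rewrite /color_law /= /mnormalize rT/= eqe gt_eqF//= .
Qed.

Lemma fine_color_law z A : measurable A ->
  fine (color_law z A) = sigma^-1 * fine (rho z A).
Proof.
move=> mA; rewrite color_lawE -[rho z A]fineK ?(rho_fin rhoT)//.
by rewrite mulrC.
Qed.

Lemma measurable_color_law : measurable_fun [set: S] color_law.
Proof. exact: measurable_fun_mnormalize. Qed.

(** The mass of the composition at time [n]. *)
Definition total_mass (n : nat) : R := fine (m0 setT) + n%:R * sigma.

Lemma m0_gt0 : 0 < fine (m0 setT).
Proof.
by rewrite lt_neqAle fine_ge0// andbT eq_sym fine_eq0 ?fin_num_measure.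
Qed.

Lemma total_mass_gt0 n : 0 < total_mass n.
Proof. by rewrite ltr_wpDr ?m0_gt0// mulr_ge0// ltW. Qed.

Lemma total_massS n : total_mass n.+1 = total_mass n + sigma.
Proof. by rewrite /total_mass -natr1 mulrDl mul1r addrA. Qed.

(** The weight of the replacement measure in the normalized composition at
    time [n.+1]. *)
Definition gain (n : nat) : R := sigma / total_mass n.+1.

Lemma gain01 n : 0 <= gain n <= 1.
Proof.
apply/andP; split; first by rewrite /gain divr_ge0// ltW// total_mass_gt0.
rewrite /gain ler_pdivrMr ?total_mass_gt0// mul1r.
by rewrite total_massS lerDr ltW// total_mass_gt0.
Qed.

Lemma harmonic_gain n :
  sigma / (fine (m0 setT) + sigma) * harmonic n <= gain n.
Proof.
rewrite /gain /harmonic/= -mulrA -invfM; apply: (ler_wpM2l (ltW sigma_gt0)).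
have s0 : 0 < fine (m0 setT) + sigma by rewrite ltr_wpDr ?m0_gt0// ltW.
rewrite lef_pV2 ?posrE ?total_mass_gt0//; last by rewrite mulr_gt0.
rewrite /total_mass mulrDl (mulrC sigma) lerD2r.
by rewrite ler_peMr ?ler1n// ltW// m0_gt0.
Qed.

Lemma gain_harmonic n : gain n <= harmonic n.
Proof.
rewrite /gain /harmonic/= ler_pdivrMr ?total_mass_gt0// mulrC ler_pdivlMr//.
by rewrite /total_mass mulrC lerDr ltW// m0_gt0.
Qed.

Lemma cvg_gain : gain @ \oo --> 0.
Proof.
apply: (@squeeze_cvgr _ _ _ _ (fun=> 0) (@harmonic R)).
- by apply: nearW => n; rewrite gain_harmonic andbT; have /andP[] := gain01 n.
- exact: cvg_cst.
- exact: cvg_harmonic.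
Qed.

Lemma dvg_series_gain : series gain @ \oo --> +oo.
Proof.
have hy : series (@harmonic R) @ \oo --> +oo.
  apply: nondecreasing_dvgn_lt; last exact: dvg_harmonic.
  by apply: nondecreasing_series => n _ _; exact: harmonic_ge0.
set k := sigma / (fine (m0 setT) + sigma).
have k0 : 0 < k by rewrite divr_gt0// ltr_wpDr ?m0_gt0// ltW.
apply/cvgryPge => A; have [N _ HN] := cvgry_ge hy (A / k).
exists N => // n /HN/=; rewrite ler_pdivrMr// => /le_trans; apply.
rewrite /series/= mulr_suml; apply: ler_sum => i _.
by rewrite mulrC; exact: harmonic_gain.
Qed.

(** The normalized composition as a function of the drawn pairs [c], on an
    arbitrary sample space: it is used both on [Omega] and on [Omega] with the
    coarser sigma-algebra of the past. *)
Fixpoint polya (T : Type) (c : nat -> T -> S) (n : nat) (w : T) : M :=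
  if n is k.+1 then next color_law (gain01 k) (polya c k w) (c k w)
  else normalized m0.

Lemma measurable_polya d' (T : measurableType d') (c : nat -> T -> S) n :
  (forall k, (k < n)%N -> measurable_fun [set: T] (c k)) ->
  measurable_fun [set: T] (polya c n).
Proof.
elim: n => [|n IH] mc //=.
apply: (measurableT_comp (measurable_next measurable_color_law (gain01 n))
  (_ : measurable_fun setT (fun w => (polya c n w, c n w)))).
by apply: measurable_fun_pair; [apply: IH => k kn; apply: mc; exact: ltnW|exact: mc].
Qed.

Context d' (Omega : measurableType d') (P : probability Omega R).
Variables (C1 C2 : nat -> {RV P >-> C}).
Let c n (w : Omega) : S := (C1 n w, C2 n w).

Lemma compositionE n w A : measurable A ->
  composition rho m0 C1 C2 n w A = ((total_mass n)%:E * polya c n w A)%E.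
Proof.
move=> mA; elim: n => [|n IH].
  rewrite /= /total_mass mul0r addr0 fineK ?fin_num_measure// /normalized/=.
  rewrite /mnormalize (negbTE m0_neq0)/= ifF; last first.
    by apply/negbTE; rewrite -ltey -ge0_fin_numE// fin_num_measure.
  rewrite muleCA -[X in (_ = _ * (X * _))%E]fineK ?fin_num_measure//.
  by rewrite -EFinM divff ?mule1// gt_eqF// m0_gt0.
transitivity (composition rho m0 C1 C2 n w A + rho (c n w) A)%E.
  exact: measure_addE.
have -> : polya c n.+1 w A = ((1 - gain n) * fine (polya c n w A) +
    gain n * fine (color_law (c n w) A))%:E.
  by rewrite -(fine_mixture (gain01 n))// fineK// fin_num_measure.
rewrite IH fine_color_law// -{1}[polya c n w A]fineK ?fin_num_measure//.
rewrite -{1}[rho (c n w) A]fineK ?(rho_fin rhoT)// -!EFinM -EFinD; congr EFin.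
rewrite /gain; have := total_mass_gt0 n.+1; rewrite total_massS => t0.
by field; rewrite !gt_eqF.
Qed.

Lemma norm_compositionE n w A : measurable A ->
  norm_composition rho m0 C1 C2 n w A = polya c n w A.
Proof.
move=> mA; rewrite /norm_composition /normalized/= /mnormalize.
have t0 := total_mass_gt0 n.
have -> : composition rho m0 C1 C2 n w setT = (total_mass n)%:E.
  by rewrite compositionE// [X in (_ * X)%E](probability_setT (polya c n w)) mule1.
rewrite eqe gt_eqF//= compositionE//.
by rewrite muleAC -EFinM mulfV ?gt_eqF// mul1e.
Qed.

Hypothesis draws : polya_draws rho m0 C1 C2.

Let mc n : measurable_fun [set: Omega] (c n).
Proof. by apply: measurable_fun_pair. Qed.

Let mp n : measurable_fun [set: Omega] (polya c n).
Proof. exact: measurable_polya. Qed.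

(** The composition at time [n] is measurable with respect to the first [n]
    draws. *)
Lemma polya_past n U : measurable U -> past C1 C2 n (polya c n @^-1` U).
Proof.
move=> mU.
(* [T] is [Omega] with the sigma-algebra generated by the first [n] draws. *)
pose G := \big[setU/set0]_(i < n)
  preimage_set_system setT (c i) (@measurable _ S).
pose T := g_sigma_algebraType G.
have mcT k : (k < n)%N -> measurable_fun [set: T] (c k : T -> S).
  move=> kn _ Y mY; rewrite setTI.
  apply: sub_sigma_algebra; rewrite /G.
  rewrite -(bigcup_mkord n (fun i => preimage_set_system setT (c i) (@measurable _ S))).
  by exists k => //=; exists Y; rewrite ?setTI.
have := @measurable_polya _ T c n mcT measurableT U mU.
by rewrite setTI.
Qed.

Lemma draws_sqprob n A U : measurable A -> measurable U ->
  P ((polya c n @^-1` U) `&` (c n @^-1` A)) =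
   (\int[P]_(w in polya c n @^-1` U) sqprob (polya c n w) A)%E.
Proof.
move=> mA mU; have := draws mA (@polya_past n _ mU) => ->.
apply: eq_integral => w _; rewrite /sqprob/= /product_measure1.
rewrite (@eq_measure_integral _ _ _ _ (polya c n w)); last first.
  by move=> B mB _; exact: norm_compositionE.
apply: eq_integral => x _ /=; apply: norm_compositionE.
exact: measurable_xsection.
Qed.

(** The Markov property: the joint law of the composition and the next pair is
    determined by its values on rectangles, which form a pi-system. *)
Lemma polya_markov n (F : M * S -> R) : bmfun F ->
  \int[P]_w F (polya c n w, c n w) =
  \int[P]_w \int[sqprob (polya c n w)]_x F (polya c n w, x).
Proof.
move=> bF.
have mmc : measurable_fun setT (fun w => (polya c n w, c n w)).
  exact: measurable_fun_pair.
(* [k1 w] is the Dirac mass at the composition and the pair actually drawn;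
   [k2 w] redraws the pair from its conditional law. *)
pose k1 w : pprobability (M * S)%type R := \d_(polya c n w, c n w).
have mk1 : measurable_fun setT k1 by exact: measurableT_comp (@measurable_pdirac _ _ R) mmc.
pose k2 w : pprobability (M * S)%type R := (\d_(polya c n w) \x sqprob (polya c n w))%E.
have mk2 : measurable_fun setT k2.
  apply: (measurableT_comp (@measurable_product _ _ M S R)
    (_ : measurable_fun setT (fun w => (\d_(polya c n w) : pprobability M R, sqprob (polya c n w))))).
  apply: measurable_fun_pair.
    exact: measurableT_comp (@measurable_pdirac _ _ R) (mp n).
  exact: measurableT_comp (@measurable_sqprob _ _ R) (mp n).
have int1 (f : M * S -> R) : bmfun f ->
    \int[bind P mk1]_z f z = \int[P]_w f (polya c n w, c n w).
  move=> bf; rewrite bind_int//; apply: eq_Rintegral => w _.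
  by rewrite probRint_dirac//; exact: bf.1.
have int2 (f : M * S -> R) : bmfun f ->
    \int[bind P mk2]_z f z = \int[P]_w \int[sqprob (polya c n w)]_x f (polya c n w, x).
  move=> bf; rewrite bind_int//; apply: eq_Rintegral => w _.
  rewrite /k2 probRint_prod// probRint_dirac//.
  exact: (@probRint_bmfun _ _ _ _ _ (fun=> sqprob (polya c n w)) _ _ bf).1.
move: (bind P mk1) (bind P mk2) int1 int2 => Q1 Q2 int1 int2.
rewrite -(int1 _ bF) -(int2 _ bF).
apply: eq_probRint.
apply: (measure_unique [set A `*` B | A in measurable & B in measurable] (fun=> setT)).
- exact: measurable_prod_measurableType.
- move=> _ _ [A1 mA1 [B1 mB1 <-]] [A2 mA2 [B2 mB2 <-]].
  exists (A1 `&` A2); first exact: measurableI.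
  by exists (B1 `&` B2); [exact: measurableI|rewrite setXI].
- by move=> _; exists setT => //; exists setT => //; rewrite setXTT.
- by rewrite bigcup_const.
- move=> _ [U mU [A mA <-]].
  have mUA : measurable (U `*` A) by exact: measurableX.
  have bUA := bmfun_indic R mUA.
  apply: fine_eq_prob => //.
  rewrite -(probRint_indic Q1 mUA) -(probRint_indic Q2 mUA) (int1 _ bUA) (int2 _ bUA).
  have mPU : measurable (polya c n @^-1` U) by rewrite -[X in measurable X]setTI; exact: mp.
  have mPA : measurable (c n @^-1` A) by rewrite -[X in measurable X]setTI; exact: mc.
  transitivity (fine (P ((polya c n @^-1` U) `&` (c n @^-1` A)))).
    by rewrite -probRint_indic//; exact: measurableI.
  rewrite draws_sqprob// integral_mkcond; congr fine; apply: eq_integral => w _.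
  rewrite patchE; case: ifPn => [|]; rewrite ?inE ?notin_setE => wU.
    rewrite -[LHS]fineK ?fin_num_measure//; congr EFin.
    rewrite -probRint_indic//; apply: eq_Rintegral => x _.
    by rewrite !indicE; congr (_%:R : R); congr nat_of_bool; apply/idP/idP; rewrite !inE //= => -[].
  congr EFin; rewrite -[LHS](probRint_cst (sqprob (polya c n w))).
  by apply: eq_Rintegral => x _; rewrite indicE memNset// => -[].
- by move=> _; rewrite [X in (X < _)%E]probability_setT ltry.
Qed.

(** The fixed points of [draw_law] are the solutions of the balance equation
    of the theorem. *)
Lemma draw_law_balanced nu : tv_close (draw_law measurable_color_law nu) nu 0 <->
  balanced_fixpoint rho sigma nu.
Proof.
have key A : measurable A -> (\int[nu]_x \int[nu]_y rho (x, y) A =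
    sigma%:E * draw_law measurable_color_law nu A)%E.
  move=> mA.
  have bk := bmfun_kap measurable_color_law mA.
  rewrite -[X in (_ * X)%E]fineK ?fin_num_measure// draw_lawE//.
  rewrite probRint_prod// -EFinM -probRintZ; last first.
    exact: (@probRint_bmfun _ _ _ _ _ (fun=> nu) _ _ bk).
  rewrite EFin_probRint; last first.
    apply: bmfunZ; exact: (@probRint_bmfun _ _ _ _ _ (fun=> nu) _ _ bk).
  apply: eq_integral => x _.
  have bkx : bmfun (fun y => fine (color_law (x, y) A)).
    by apply: (bmfun_comp bk); exact: pair1_measurable.
  rewrite -probRintZ// EFin_probRint; last exact: bmfunZ.
  apply: eq_integral => y _.
  by rewrite fine_color_law// mulrA mulfV ?gt_eqF// mul1r fineK// (rho_fin rhoT).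
split=> [h A mA|h A mA].
  by rewrite key// (tv_close0_eq h).
have := h A mA; rewrite key// => /esym.
rewrite -[X in (sigma%:E * X = _)%E]fineK ?fin_num_measure//.
rewrite -[X in (_ = sigma%:E * X)%E]fineK ?fin_num_measure// -!EFinM => -[].
by move/(mulfI (lt0r_neq0 sigma_gt0)) => ->; rewrite subrr normr0.
Qed.

End urn.

Lemma polya_weak_cvg (R : realType) d (C : measTopType d)
    (rho : R.-ker (C * C)%type ~> C) d' (Omega : measurableType d')
    (P : probability Omega R) (m0 : {finite_measure set C -> \bar R})
    (C1 C2 : nat -> {RV P >-> C}) (sigma theta : R) (nu : probability C R) :
  m0 setT != 0%E -> polya_draws rho m0 C1 C2 -> 0 < sigma ->
  (forall x y : C, rho (x, y) setT = sigma%:E) ->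
  (forall x y, tv_close (color_law rho x) (color_law rho y) theta) ->
  2 * theta < 1 -> balanced_fixpoint rho sigma nu ->
  weak_cvg_in_probability P (norm_composition rho m0 C1 C2) nu.
Proof.
move=> m0_neq0 draws sigma_gt0 rhoT dobr theta2.
move=> /(draw_law_balanced sigma_gt0 rhoT nu).2 hnu f _ bf mf eps eps0.
have bmf : bmfun f.
  split => //; have [K [_ fK]] := bf.
  by exists (K + 1) => x; apply: fK; rewrite ?ltrDl.
pose c n (w : Omega) := (C1 n w, C2 n w).
have mc n : measurable_fun setT (c n) by exact: measurable_fun_pair.
pose g01 := gain01 sigma_gt0 m0_neq0.
have := @process_cvg _ _ _ _ (measurable_color_law rho) _ dobr theta2
  (gain sigma m0) g01 _ Omega P (polya rho sigma_gt0 m0_neq0 c) c.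
move=> /(_ (fun n => measurable_polya _ _ _ (fun k _ => mc k))).
move=> /(_ mc (fun _ _ => erefl) (fun _ _ => erefl)).
move=> /(_ (polya_markov sigma_gt0 rhoT m0_neq0 draws) nu hnu f eps bmf eps0).
move=> /(_ (cvg_gain sigma_gt0 m0_neq0) (dvg_series_gain sigma_gt0 m0_neq0)).
rewrite (_ : (fun n => P [set w | eps <=
    `|\int[norm_composition rho m0 C1 C2 n w]_x f x - \int[nu]_x f x|]) =
  (fun n => P [set w | eps <=
    `|\int[polya rho sigma_gt0 m0_neq0 c n w]_x f x - \int[nu]_x f x|]))//.
apply/funext => n; congr (P _); apply/funext => w /=.
rewrite (@eq_probRint _ _ _ _ (polya rho sigma_gt0 m0_neq0 c n w))// => A.
exact: norm_compositionE.
Qed.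

Local Open Scope ereal_scope.

Theorem theorem6p5 (R : realType) (d : measure_display) (C : measTopType d)
    (rho : R.-ker (C * C)%type ~> C)
    (d' : measure_display) (Omega : measurableType d')
    (P : probability Omega R)
    (m0 : {finite_measure set C -> \bar R}) (C1 C2 : nat -> {RV P >-> C})
    (sigma : R) :
  m0 setT != 0 ->
  polya_draws rho m0 C1 C2 ->
  (0 < sigma)%R ->
  (forall x y : C, rho (x, y) setT = sigma%:E) ->
  tau_l (pair_operator rho sigma) + tau_r (pair_operator rho sigma) < 1 ->
  exists nu : probability C R,
    [/\ balanced_fixpoint rho sigma nu,
        forall nu' : probability C R, balanced_fixpoint rho sigma nu' ->
          forall A, measurable A -> nu' A = nu A &
        weak_cvg_in_probability P (norm_composition rho m0 C1 C2) nu].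
Proof.
move=> m0_neq0 draws sigma_gt0 rhoT tau1.
have [theta theta2 hth] := ex_dobrushin sigma_gt0 rhoT tau1.
pose mk := measurable_color_law rho.
have dobr x y : tv_close (color_law rho x) (color_law rho y) theta.
  by move=> A mA; rewrite !(fine_color_law sigma_gt0 rhoT)//; exact: hth.
have [nu hnu] := draw_law_fixpoint_exists mk dobr theta2.
have fixP := draw_law_balanced sigma_gt0 rhoT.
exists nu; split; first exact: (fixP nu).1.
  move=> nu' /(fixP nu').2 hnu'.
  exact: (tv_close0_eq (draw_law_fixpoint_unique dobr theta2 hnu' hnu)).
exact: (polya_weak_cvg m0_neq0 draws sigma_gt0 rhoT dobr theta2 ((fixP nu).1 hnu)).
Qed.
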